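(* Let $(M,\omega)$ be a symplectic manifold, let $(P_1,\{\cdot,\cdot\}_1)$ and $(P_2,\{\cdot,\cdot\}_2)$ be Poisson manifolds, and let $\pi_1:M\to P_1$ and $\pi_2:M\to P_2$ be surjective submersive Poisson maps. Consider the diagram $P_1\stackrel{\pi_1}{\leftarrow}M\stackrel{\pi_2}{\rightarrow}P_2$. \begin{enumerate} \item If the diagram is a (regular) Howe dual pair and $\dim P_1+\dim P_2=\dim M$, then it is a (regular) local Howe dual pair. \item If the diagram is a (regular) local Howe dual pair and the fibers of $\pi_1$ and of $\pi_2$ are connected, then it is a (regular) Howe dual pair. \end{enumerate}
   Context: All manifolds are smooth and paracompact. The Hamiltonian vector field $X_h$ of $h\in C^\infty(M)$ is defined by $\mathbf{d}h=\omega(X_h,\cdot)$. The Poisson bracket on $(M,\omega)$ is the one determined by $\omega$, i.e. $\{g,h\}=\omega(X_g,X_h)$. Poisson maps are smooth maps whose pull-back preserves Poisson brackets. For $U\subset M$ open and $j=1,2$, let $\mathcal{F}_j(U)=\pi_j^*(C^\infty(\pi_j(U)))$, that is, the set of functions on $U$ of the form $g\circ\pi_j|_U$ with $g\in C^\infty(\pi_j(U))$ (here $\pi_j(U)$ is open in $P_j$ since $\pi_j$ is a submersion). This is a Poisson subalgebra of $C^\infty(U)$. Write $\mathcal{F}_j=\mathcal{F}_j(M)=\pi_j^*(C^\infty(P_j))$. For a subset $A\subset C^\infty(U)$, its centralizer is $A^c=\{f\in C^\infty(U)\mid \{f,g\}^U=0 \text{ for all } g\in A\}$, where $\{\cdot,\cdot\}^U$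 is the restriction of the Poisson bracket of $M$ to $U$. Howe dual pair: $\mathcal{F}_1^c=\mathcal{F}_2$ and $\mathcal{F}_2^c=\mathcal{F}_1$ in $C^\infty(M)$. Local Howe dual pair: for each $m\in M$ and each neighbourhood $V$ of $m$ there is a neighbourhood $U$ of $m$ with $U\subset V$ such that $\mathcal{F}_1(U)$ and $\mathcal{F}_2(U)$ centralize each other in $C^\infty(U)$, i.e. $\mathcal{F}_1(U)^c=\mathcal{F}_2(U)$ and $\mathcal{F}_2(U)^c=\mathcal{F}_1(U)$ (neighbourhoods $U$ are open). In each case the dual pair is called regular when $\pi_1$ and $\pi_2$ are surjective submersions. *)

(* Defs.v *)
(* MathComp / MathComp-Analysis *)
From HB Require Import structures.
From mathcomp Require Import all_boot all_order all_algebra.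
From mathcomp Require Import all_classical all_reals all_analysis.

Set Implicit Arguments.
Unset Strict Implicit.
Unset Printing Implicit Defensive.

Import Order.TTheory GRing.Theory Num.Theory.
Import numFieldNormedType.Exports.

Local Open Scope classical_set_scope.
Local Open Scope ring_scope.

(* C^k on an open set A of R^n, by iterated partial derivatives; the values of
   f outside A are irrelevant. *)
Fixpoint cont_diff {R : realType} {n : nat} (k : nat) (A : set 'rV[R]_n)
    (f : 'rV[R]_n -> R) : Prop :=
  {in A, continuous f} /\
  if k is k'.+1 then
    forall i : 'I_n,
      (forall x, A x -> derivable f x (delta_mx 0 i)) /\
      cont_diff k' A (fun x => 'D_(delta_mx 0 i) f x)
  else True.

Definition smooth_on {R : realType} {n : nat} (A : set 'rV[R]_n)
    (f : 'rV[R]_n -> R) : Prop :=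
  forall k, cont_diff k A f.

Definition smooth_vec_on {R : realType} {n p : nat} (A : set 'rV[R]_n)
    (f : 'rV[R]_n -> 'rV[R]_p) : Prop :=
  forall j : 'I_p, smooth_on A (fun x => f x 0 j).

Definition paracompact (T : topologicalType) : Prop :=
  forall C : set (set T),
    (forall A, C A -> open A) -> (forall x, exists2 A, C A & A x) ->
    exists D : set (set T),
      [/\ forall B, D B -> open B,
          forall x, exists2 B, D B & B x,
          forall B, D B -> exists2 A, C A & B `<=` A &
          forall x : T, exists2 N, nbhs x N &
            finite_set [set B | D B /\ B `&` N !=set0]].

(* Both components of a chart are total functions; only the restrictions to
   the domain and to its image are meaningful. *)
Record chart (R : realType) (n : nat) (T : topologicalType) := Chart {
  chart_dom : set T;
  chart_map : T -> 'rV[R]_n;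
  chart_inv : 'rV[R]_n -> T;
  chart_dom_open : open chart_dom;
  chart_cod_open : open (chart_map @` chart_dom);
  chart_mapK : {in chart_dom, cancel chart_map chart_inv};
  chart_map_continuous : {in chart_dom, continuous chart_map};
  chart_inv_continuous : {in chart_map @` chart_dom, continuous chart_inv}
}.

(* Smooth manifolds of pure dimension n, possibly empty and not necessarily
   connected. The preferred chart at each point serves to
   identify every tangent space with R^n. *)
Record manifold (R : realType) (n : nat) := Manifold {
  manifold_carrier :> topologicalType;
  atlas : set (chart R n manifold_carrier);
  chart_at : manifold_carrier -> chart R n manifold_carrier;
  atlas_chart_at : forall m, atlas (chart_at m);
  mem_chart_at : forall m, chart_dom (chart_at m) m;
  atlas_compatible : forall c d, atlas c -> atlas d ->
    smooth_vec_on (chart_map c @` (chart_dom c `&` chart_dom d))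
                  (chart_map d \o chart_inv c);
  manifold_hausdorff : hausdorff_space manifold_carrier;
  manifold_paracompact : paracompact manifold_carrier
}.

(* For U open, the functions M -> R whose restriction to U belongs to C^oo(U).
   C^oo(U) itself is the quotient by equality on U, and the sets of functions
   on U considered below are all saturated for that equality. *)
Definition smooth_fun {R : realType} {n : nat} {M : manifold R n} (U : set M)
    (f : M -> R) : Prop :=
  forall c, atlas c ->
    smooth_on (chart_map c @` (chart_dom c `&` U)) (f \o chart_inv c).

Definition smooth_map {R : realType} {n p : nat} {M : manifold R n}
    {P : manifold R p} (f : M -> P) : Prop :=
  continuous f /\
  forall c d, atlas c -> atlas d ->
    smooth_vec_on (chart_map c @` (chart_dom c `&` f @^-1` chart_dom d))
                  (chart_map d \o f \o chart_inv c).

(* A tangent vector at m is the row of its coordinates in chart_at m. *)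
Definition differential {R : realType} {n : nat} {M : manifold R n}
    (f : M -> R) (m : M) : 'rV[R]_n -> R :=
  'd (f \o chart_inv (chart_at m)) (chart_map (chart_at m) m).

Definition tangent_map {R : realType} {n p : nat} {M : manifold R n}
    {P : manifold R p} (f : M -> P) (m : M) : 'rV[R]_n -> 'rV[R]_p :=
  'd (chart_map (chart_at (f m)) \o f \o chart_inv (chart_at m))
     (chart_map (chart_at m) m).

Definition submersion {R : realType} {n p : nat} {M : manifold R n}
    {P : manifold R p} (f : M -> P) : Prop :=
  smooth_map f /\ forall m v, exists u, tangent_map f m u = v.

(* The i-th coordinate vector field of the chart c, at the point with
   coordinates x in c. *)
Definition coord_vec {R : realType} {n : nat} {M : manifold R n}
    (c : chart R n M) (i : 'I_n) (x : 'rV[R]_n) : 'rV[R]_n :=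
  'd (chart_map (chart_at (chart_inv c x)) \o chart_inv c) x (delta_mx 0 i).

Definition form_coef {R : realType} {n : nat} {M : manifold R n}
    (w : M -> 'rV[R]_n -> 'rV[R]_n -> R) (c : chart R n M) (i j : 'I_n)
    (x : 'rV[R]_n) : R :=
  w (chart_inv c x) (coord_vec c i x) (coord_vec c j x).

Record symplectic_form (R : realType) (n : nat) (M : manifold R n) :=
  SymplecticForm {
  form_at :> M -> 'rV[R]_n -> 'rV[R]_n -> R;
  form_linearl : forall m a u v z,
    form_at m (a *: u + v) z = a * form_at m u z + form_at m v z;
  form_linearr : forall m a u v z,
    form_at m z (a *: u + v) = a * form_at m z u + form_at m z v;
  form_alternating : forall m u, form_at m u u = 0;
  form_nondegenerate : forall m u, (forall v, form_at m u v = 0) -> u = 0;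
  form_smooth : forall c i j, atlas c ->
    smooth_on (chart_map c @` chart_dom c) (form_coef form_at c i j);
  form_closed : forall c i j k x, atlas c -> (chart_map c @` chart_dom c) x ->
    'D_(delta_mx 0 i) (form_coef form_at c j k) x +
    'D_(delta_mx 0 j) (form_coef form_at c k i) x +
    'D_(delta_mx 0 k) (form_coef form_at c i j) x = 0
}.

Definition hamiltonian {R : realType} {n : nat} {M : manifold R n}
    (w : symplectic_form M) (h : M -> R) (m : M) : 'rV[R]_n :=
  xget 0 [set X | forall v, differential h m v = w m X v].

(* The value at m depends only on the germs of g and h at m, so that the same
   operation also gives the restricted bracket on each open set. *)
Definition symplectic_bracket {R : realType} {n : nat} {M : manifold R n}
    (w : symplectic_form M) (g h : M -> R) : M -> R :=
  fun m => w m (hamiltonian w g m) (hamiltonian w h m).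

(* The bracket is only constrained on smooth functions. *)
Record poisson_structure (R : realType) (n : nat) (P : manifold R n) :=
  PoissonStructure {
  bracket :> (P -> R) -> (P -> R) -> P -> R;
  bracket_smooth : forall f g, smooth_fun setT f -> smooth_fun setT g ->
    smooth_fun setT (bracket f g);
  bracket_linear : forall (a : R) f g h,
    smooth_fun setT f -> smooth_fun setT g -> smooth_fun setT h ->
    bracket (fun x => a * f x + g x) h =
      (fun x => a * bracket f h x + bracket g h x);
  bracket_antisym : forall f g, smooth_fun setT f -> smooth_fun setT g ->
    bracket f g = (fun x => - bracket g f x);
  bracket_jacobi : forall f g h,
    smooth_fun setT f -> smooth_fun setT g -> smooth_fun setT h ->
    forall x, bracket f (bracket g h) x + bracket g (bracket h f) x +
              bracket h (bracket f g) x = 0;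
  bracket_leibniz : forall f g h,
    smooth_fun setT f -> smooth_fun setT g -> smooth_fun setT h ->
    bracket (fun x => f x * g x) h =
      (fun x => f x * bracket g h x + g x * bracket f h x)
}.

Definition poisson_map {R : realType} {n p : nat} {M : manifold R n}
    {P : manifold R p} (bM : (M -> R) -> (M -> R) -> M -> R)
    (bP : (P -> R) -> (P -> R) -> P -> R) (f : M -> P) : Prop :=
  smooth_map f /\
  forall g h, smooth_fun setT g -> smooth_fun setT h ->
    bM (g \o f) (h \o f) = bP g h \o f.

Definition pullbacks {R : realType} {n p : nat} {M : manifold R n}
    {P : manifold R p} (f : M -> P) (U : set M) : set (M -> R) :=
  [set h | exists2 g : P -> R,
     smooth_fun (f @` U) g & forall m, U m -> h m = g (f m)].

Definition centralizer {R : realType} {n : nat} {M : manifold R n}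
    (w : symplectic_form M) (U : set M) (A : set (M -> R)) : set (M -> R) :=
  [set f | smooth_fun U f /\
     forall g, A g -> forall m, U m -> symplectic_bracket w f g m = 0].

Definition mutual_centralizers {R : realType} {n n1 n2 : nat}
    {M : manifold R n} {P1 : manifold R n1} {P2 : manifold R n2}
    (w : symplectic_form M) (pi1 : M -> P1) (pi2 : M -> P2) (U : set M) :
    Prop :=
  centralizer w U (pullbacks pi1 U) = pullbacks pi2 U /\
  centralizer w U (pullbacks pi2 U) = pullbacks pi1 U.

Definition howe_dual_pair {R : realType} {n n1 n2 : nat}
    {M : manifold R n} {P1 : manifold R n1} {P2 : manifold R n2}
    (w : symplectic_form M) (pi1 : M -> P1) (pi2 : M -> P2) : Prop :=
  mutual_centralizers w pi1 pi2 setT.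

Definition local_howe_dual_pair {R : realType} {n n1 n2 : nat}
    {M : manifold R n} {P1 : manifold R n1} {P2 : manifold R n2}
    (w : symplectic_form M) (pi1 : M -> P1) (pi2 : M -> P2) : Prop :=
  forall (m : M) (V : set M), nbhs m V ->
    exists U : set M,
      [/\ open U, U m, U `<=` V & mutual_centralizers w pi1 pi2 U].

(* Main.v *)
(* Local sections and bump functions show that, at each point m, the differentials
   of the functions pulled back by pi_j fill the annihilator of ker T_m pi_j.
   Hence the pulled-back algebras commute iff the Hamiltonian vectors of either
   lie in the kernel of the other projection. If moreover dim P1 + dim P2 = dim M,
   these vectors fill the kernel, so that a function commuting with F_1(U) is
   locally constant along the fibres of pi_2 in U. It descends to pi_2(U) as soon
   as these fibres are connected, which holds, simultaneously for pi_1 and pi_2,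
   when U is a small Euclidean ball in a chart: a local diffeomorphism maps small
   balls to convex sets, and a submersion is linear in a suitable chart.
   Conversely, for a local Howe dual pair a function commuting with F_1 is locally
   of the form g o pi_2, hence constant on the fibres of pi_2 if these are
   connected. *)
Require Import Defs.
From HB Require Import structures.
From mathcomp Require Import all_boot all_order all_algebra.
From mathcomp Require Import all_classical all_reals all_analysis.
From mathcomp Require Import ring lra.
Set Implicit Arguments.
Unset Strict Implicit.
Unset Printing Implicit Defensive.
Import Order.TTheory GRing.Theory Num.Theory.
Import numFieldNormedType.Exports.
Local Open Scope classical_set_scope.
Local Open Scope ring_scope.

(** Two obstacles shape the proof. An element of F_j(U) comes from a function on pi_j(U) that need
    not extend to P_j. The bracket at a point sees only differentials there, so at each point such
    an element can be traded for a global pullback with the same Hamiltonian vector; this is how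
    information passes between M and U. The other obstacle is that one U must suit both projections:
    a box adapted to the straightening chart of one is not adapted to the other. A Euclidean ball is
    adapted to neither, but it tolerates any change of chart tangent to the identity: the squared
    distance to the centre keeps its Hessian at the centre, hence stays quasiconvex nearby. As
    smoothness means iterated partial derivatives, Frechet differentiability has to be recovered
    from continuous partials. The inverse function theorem is proved for maps whose derivative at
    the centre is the identity, and submersions are straightened by maps of exactly this kind. *)

Section Differentiability.
Context {R : realType}.

(** * Frechet differentiability, partial derivatives and mean values *)

Lemma differentiable_epsP (V W : normedModType R) (f : V -> W) (x : V)
    (L : {linear V -> W}) : continuous L ->
  (forall e, 0 < e -> \forall h \near 0, `|f (h + x) - f x - L h| <= e * `|h|) ->
  differentiable f x /\ 'd f x = L :> (V -> W).
Proof.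
move=> Lc H.
have E : f \o shift x = cst (f x) + L +o_ 0 id.
  apply/eqaddoP => e e0; near=> h.
  rewrite /= opprD addrA.
  by near: h; exact: H.
have dE := diff_unique Lc E.
by split => //; apply/diff_locallyP; rewrite dE; split.
Unshelve. all: by end_near. Qed.

Lemma differentiable_eps (V W : normedModType R) (f : V -> W) (x : V) (e : R) :
  differentiable f x -> 0 < e ->
  \forall h \near 0, `|f (h + x) - f x - 'd f x h| <= e * `|h|.
Proof.
move=> /diff_locally /eqaddoP /(_ e) H /H.
apply: filterS => h.
by rewrite /= opprD addrA.
Qed.

Lemma normr_rV_le n (v : 'rV[R]_n) (c : R) :
  0 <= c -> (forall i, `|v 0 i| <= c) -> `|v| <= c.
Proof.
move=> c0 H; rewrite /Num.Def.normr/= mx_normrE.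
by apply: bigmax_le => // -[i j] _ /=; rewrite ord1.
Qed.

Lemma normr_coord_le n (v : 'rV[R]_n) i : `|v 0 i| <= `|v|.
Proof.
rewrite [leRHS]/Num.Def.normr/= mx_normrE.
exact: (le_bigmax _ (fun ij => `|v ij.1 ij.2|) (0, i)).
Qed.

Lemma linear_rV_continuous n (W : normedModType R) (L : {linear 'rV[R]_n -> W}) :
  continuous L.
Proof.
have LE v : L v = \sum_(i < n) v 0 i *: L (delta_mx 0 i).
  rewrite {1}[v]row_sum_delta linear_sum.
  by apply: eq_bigr => i _; rewrite linearZ.
apply/linear_bounded_continuous; apply/ex_bound.
exists (\sum_(i < n) `|L (delta_mx 0 i)|).
apply: filterS (nbhs0_lt ltr01) => v v1 /=.
rewrite LE (le_trans (ler_norm_sum _ _ _))//; apply: ler_sum => i _.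
rewrite normrZ ler_piMl//; exact: le_trans (normr_coord_le v i) (ltW v1).
Qed.

Lemma derivable_line (V W : normedModType R) (f : V -> W) y v s :
  derivable f (s *: v + y) v ->
  is_derive s 1 (fun t : R => f (t *: v + y)) ('D_v f (s *: v + y)).
Proof.
set g1 := fun h : R => h^-1 *: (f (h *: v + (s *: v + y)) - f (s *: v + y)).
set g2 := fun h : R => h^-1 *: (f ((h + s) *: v + y) - f (s *: v + y)).
have E : g1 = g2 by apply/funext => h; rewrite /g1 /g2 scalerDl addrA.
have E2 : g2 = (fun h => h^-1 *: (((fun t : R => f (t *: v + y)) \o shift s)
      (h *: 1) - f (s *: v + y))).
  by apply/funext => h; rewrite /g2 /= [h *: 1]mulr1.
rewrite /derivable /derive -/g1 E E2 => H; split => //.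
Qed.

(** Only derivability in the direction [v] is at hand, so no differential of [f] is available; the
    restriction of [f] to a line is a function of one real variable, where derivable means
    differentiable and the chain rule applies. *)
Lemma is_deriveZdir (V W : normedModType R) (f : V -> W) x v c :
  derivable f x v -> is_derive x (c *: v) f (c *: 'D_v f x).
Proof.
move=> fxv; have [->|c0] := eqVneq c 0.
  by rewrite !scale0r; exact: is_derive0.
have D : is_derive (0 : R) 1 (fun t : R => f (t *: v + x)) ('D_v f x).
  have := @derivable_line _ _ f x v 0; rewrite scale0r add0r; exact.
have /derivable1_diffP dD := @ex_derive _ _ _ _ _ _ _ D.
have mc : is_diff (0 : R) (fun t : R => t * c) (fun t : R => t * c).
  rewrite (_ : (fun t : R => t * c) = ( *:%R^~ c))//; exact: is_diff_scalel.
have E : (fun t : R => f (t *: (c *: v) + x)) =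
   (fun t : R => f (t *: v + x)) \o (fun t : R => t * c).
  by apply/funext => t /=; rewrite scalerA.
have dc : differentiable (fun t : R => f (t *: (c *: v) + x)) (0 : R).
  rewrite E; apply: differentiable_comp => //=; by rewrite mul0r.
have fxcv : derivable f x (c *: v).
  by apply/derivable1P/derivable1_diffP.
split => //.
have := @derivable_line _ _ f x (c *: v) 0; rewrite scale0r add0r => /(_ fxcv).
move=> /@derive_val <-; rewrite deriveE//.
rewrite E diff_comp//=; last by rewrite mul0r.
rewrite (@diff_val _ _ _ _ _ _ _ mc) mul0r mul1r.
rewrite -[X in 'd _ _ X]mulr1 -[X in 'd _ _ X]/(c *: (1 : R)) linearZ/=.
by rewrite -deriveE// derive_val.
Qed.

Lemma line_MVT (V : normedModType R) (f : V -> R) y v :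
  (forall s : R, 0 <= s <= 1 -> derivable f (s *: v + y) v) ->
  exists2 s : R, 0 <= s <= 1 & f (v + y) - f y = 'D_v f (s *: v + y).
Proof.
move=> H; pose g (t : R) : R := f (t *: v + y).
pose dg (s : R) : R := 'D_v f (s *: v + y).
have D (s : R) : s \in `[0, 1]%R -> is_derive s 1 g (dg s).
  by rewrite in_itv/= => /H; exact: derivable_line.
have D' (s : R) : s \in `]0, 1[%R -> is_derive s 1 g (dg s).
  by move=> /subset_itv_oo_cc; exact: D.
have C : {within `[0, 1], continuous g}.
  by apply: derivable_within_continuous => s /D [].
have [s sI] := MVT_segment ler01 D' C.
rewrite /g scale1r scale0r add0r subr0 mulr1 => ->.
by exists s => //; move: sI; rewrite in_itv.
Qed.

(** The increment of [f] is split along the staircase [p], which changes one coordinate at a time;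
    on each step the mean value theorem yields a partial derivative at a point near [x], hence close
    to its value at [x]. *)
Lemma C1_differentiable n (f : 'rV[R]_n -> R) x :
  (forall i, \forall y \near x, derivable f y (delta_mx 0 i)) ->
  (forall i, {for x, continuous (fun y => 'D_(delta_mx 0 i) f y)}) ->
  differentiable f x.
Proof.
move=> fd fc.
pose L (h : 'rV[R]_n) : R := \sum_(i < n) h 0 i * 'D_(delta_mx 0 i) f x.
have Llin : linear L.
  move=> a u v; rewrite /L scaler_sumr -big_split/=; apply: eq_bigr => i _.
  by rewrite !mxE mulrDl -mulrA.
pose LM := GRing.isLinear.Build _ _ _ _ _ Llin.
pose LL : {linear _ -> _} := HB.pack L LM.
apply: (proj1 (@differentiable_epsP _ _ f x LL (@linear_rV_continuous _ _ LL) _)).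
move=> e e0.
(* Sharing [e] among [n.+1] terms rather than [n] avoids a division by zero when [n = 0]; the
   surplus term is nonnegative and is dropped below. *)
have n0 : 0 < n.+1%:R :> R by [].
have : \forall y \near x, forall i : 'I_n, derivable f y (delta_mx 0 i) /\
    `|'D_(delta_mx 0 i) f y - 'D_(delta_mx 0 i) f x| <= e / n.+1%:R.
  near=> y; move=> i; move: i; near: y; apply: filter_forall => i; near=> y.
  split; first by near: y; exact: fd.
  rewrite distrC; near: y; move/cvgrPdist_le : (fc i); apply.
  by rewrite divr_gt0.
move=> /nbhs_normP[d /= d0 H]; apply: filterS (nbhs0_lt d0) => h hd.
pose p k : 'rV[R]_n := \row_i (if (i < k)%N then h 0 i else 0).
have p0 : p 0%N = 0 by apply/rowP => i; rewrite !mxE.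
have pn : p n = h by apply/rowP => i; rewrite !mxE ltn_ord.
have pS (k : 'I_n) : p k.+1 = h 0 k *: delta_mx 0 k + p k.
  apply/rowP => i; rewrite !mxE eqxx/= ltnS leq_eqVlt val_eqE/=.
  have [->|_] /= := eqVneq i k; first by rewrite ltnn mulr1 addr0.
  by rewrite mulr0 add0r.
have -> : f (h + x) - f x = \sum_(k < n) (f (p k.+1 + x) - f (p k + x)).
  rewrite -(big_mkord xpredT (fun k => f (p k.+1 + x) - f (p k + x))).
  by rewrite telescope_sumr// p0 pn add0r.
rewrite /LL/= /L -sumrB (le_trans (ler_norm_sum _ _ _))//.
have -> : e * `|h| = \sum_(k < n.+1) (e / n.+1%:R * `|h|).
  by rewrite sumr_const card_ord -[RHS]mulr_natl [RHS]mulrA [X in _ = X * _]mulrC divfK// gt_eqF.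
rewrite [leRHS]big_ord_recr/= -[leLHS]addr0 lerD//; last first.
  by rewrite mulr_ge0// divr_ge0// ltW.
apply: ler_sum => k _.
have near_seg (s : R) : 0 <= s <= 1 ->
    `|x - (s *: (h 0 k *: delta_mx 0 k) + (p k + x))| < d.
  move=> /andP[s0 s1]; rewrite addrA opprD addrCA subrr addr0 normrN.
  apply: le_lt_trans hd; apply: normr_rV_le => // i.
  apply: le_trans (normr_coord_le h i); rewrite !mxE eqxx/=.
  have [->|ik] := eqVneq i k.
    by rewrite ltnn mulr1 addr0 normrM ler_piMl// ger0_norm.
  by rewrite !mulr0 add0r; case: ifP => // _; rewrite normr0.
rewrite pS -(addrA _ (p k) x).
have [|s sI ->] := @line_MVT _ f (p k + x) (h 0 k *: delta_mx 0 k).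
  move=> s sI; have [+ _] := H _ (near_seg s sI) k.
  by move=> /(is_deriveZdir (h 0 k))[].
have [fk lek] := H _ (near_seg s sI) k.
have := @derive_val _ _ _ _ _ _ _ (is_deriveZdir (h 0 k) fk); move=> ->.
by rewrite -mulrBr normrM mulrC ler_pM// normr_coord_le.
Unshelve. all: by end_near. Qed.

Lemma differentiable_rV (V : normedModType R) m (F : V -> 'rV[R]_m) x :
  (forall j, differentiable (fun y => F y 0 j) x) ->
  differentiable F x /\
  (forall v, 'd F x v = \row_j 'd (fun y => F y 0 j) x v).
Proof.
move=> Fd.
pose L (v : V) : 'rV[R]_m := \row_j 'd (fun y => F y 0 j) x v.
have Llin : linear L.
  by move=> a u v; apply/rowP => j; rewrite /L !mxE linearP.
pose LM := GRing.isLinear.Build _ _ _ _ _ Llin.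
pose LL : {linear _ -> _} := HB.pack L LM.
have Lc : continuous LL.
  apply/linear_bounded_continuous; apply/ex_bound.
  have k_ j : exists k : R, 0 < k /\ forall v, `|'d (fun y => F y 0 j) x v| <= k * `|v|.
    have [k k0 H] := linear_lipschitz (diff_continuous (Fd j)).
    by exists k.
  have [k Hk] := choice k_.
  exists (\sum_j k j); apply: filterS (nbhs0_lt ltr01) => v v1.
  apply: normr_rV_le => [|j]; first by apply: sumr_ge0 => j _; exact: ltW (Hk j).1.
  rewrite /= mxE (le_trans ((Hk j).2 v))// (bigD1 j)//= ler_wpDr//.
    by apply: sumr_ge0 => i _; exact: ltW (Hk i).1.
  by rewrite ler_piMr// ltW// (Hk j).1.
have [|dF dE] := @differentiable_epsP _ _ F x LL Lc.
  move=> e e0; have H : \forall h \near 0, forall j : 'I_m,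
      `|F (h + x) 0 j - F x 0 j - 'd (fun y => F y 0 j) x h| <= e * `|h|.
    by apply: filter_forall => j; exact: (differentiable_eps (Fd j)).
  apply: filterS H => h Hh; apply: normr_rV_le => [|j].
    by rewrite mulr_ge0// ltW.
  by rewrite !mxE; exact: Hh.
by split => // v; rewrite dE.
Qed.

Lemma diff_rV_coord (V : normedModType R) m (F : V -> 'rV[R]_m) x v j :
  differentiable F x -> 'd (fun y => F y 0 j) x v = 'd F x v 0 j.
Proof.
move=> dF; have dj k : differentiable (fun y => F y 0 k) x.
  by apply: (@differentiable_comp _ _ _ _ F (fun z => z 0 k)) => //;
     exact: differentiable_coord.
by have [_ ->] := differentiable_rV dj; rewrite mxE.
Qed.

Lemma diff_coord n (x v : 'rV[R]_n) j : 'd (fun y : 'rV[R]_n => y 0 j) x v = v 0 j.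
Proof.
have := @diff_rV_coord _ _ id x v j (@ex_diff _ _ _ _ _ _ _ (is_diff_id x)).
by rewrite diff_val.
Qed.

Lemma diff_rVE n (W : normedModType R) (f : 'rV[R]_n -> W) x v :
  differentiable f x -> 'd f x v = \sum_i v 0 i *: 'D_(delta_mx 0 i) f x.
Proof.
move=> fd; rewrite {1}[v]row_sum_delta linear_sum; apply: eq_bigr => i _.
by rewrite linearZ/= deriveE.
Qed.

Lemma continuous_rV (T : topologicalType) m (F : T -> 'rV[R]_m) x :
  (forall j, {for x, continuous (fun y => F y 0 j)}) -> {for x, continuous F}.
Proof.
move=> Fc; apply/cvgrPdist_le => e e0.
have : \forall t \near x, forall j : 'I_m, `|F x 0 j - F t 0 j| <= e.
  by apply: filter_forall => j; move/cvgrPdist_le : (Fc j); apply.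
apply: filterS => t Ht; apply: normr_rV_le => [|j]; first exact: ltW.
by rewrite !mxE.
Qed.

End Differentiability.

(** * Smooth functions on open sets of R^n *)

Section SmoothCalculus.
Context {R : realType}.
Implicit Types n m k : nat.

Lemma cont_diff_continuous n k (A : set 'rV[R]_n) f x :
  cont_diff k A f -> A x -> {for x, continuous f}.
Proof. by case: k => [|k] [fc _] Ax; apply: fc; exact: mem_set. Qed.

(** Derivatives are taken in the whole space and the set only lists the points where the conditions
    are tested, so the condition is pointwise. Restriction and gluing follow from this. *)
Lemma cont_diffP n k (A : set 'rV[R]_n) f :
  cont_diff k A f <-> forall x, A x -> cont_diff k [set x] f.
Proof.
elim: k f => [|k IH] f; split=> [H x Ax|H].
- split=> // y /set_mem ->; exact: cont_diff_continuous H Ax.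
- split=> // x /set_mem Ax; exact: cont_diff_continuous (H x Ax) _.
- split=> [y /set_mem ->|i]; first exact: cont_diff_continuous H Ax.
  have [_ /(_ i)[fd fk]] := H; split=> [y ->|]; first exact: fd.
  exact: ((IH _).1 fk).
- split=> [x /set_mem Ax|i]; first exact: cont_diff_continuous (H x Ax) _.
  split=> [x Ax|]; first by have [_ /(_ i)[fd _]] := H _ Ax; exact: fd.
  by apply/IH => x Ax; have [_ /(_ i)[_]] := H _ Ax.
Qed.

Lemma cont_diff_sub n k (A B : set 'rV[R]_n) f :
  B `<=` A -> cont_diff k A f -> cont_diff k B f.
Proof. by move=> BA /cont_diffP H; apply/cont_diffP => x /BA; exact: H. Qed.

Lemma cont_diff_lower n k (A : set 'rV[R]_n) f :
  cont_diff k.+1 A f -> cont_diff k A f.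
Proof.
elim: k f => [|k IH] f; first by case.
move=> [fc H]; split => // i; have [fd /IH] := H i; by split.
Qed.

Lemma open_near (T : topologicalType) (A : set T) x : open A -> A x -> \forall y \near x, A y.
Proof. by move=> oA Ax; exact: open_nbhs_nbhs. Qed.

Lemma open_near_eq (T : topologicalType) (U : Type) (A : set T) x (f g : T -> U) :
  open A -> A x -> (forall y, A y -> f y = g y) -> \forall y \near x, f y = g y.
Proof. by move=> oA Ax fg; apply: filterS (open_near oA Ax) => y; exact: fg. Qed.

Lemma near_eq_continuous (T U : topologicalType) (f g : T -> U) x :
  (\forall y \near x, f y = g y) -> {for x, continuous f} ->
  {for x, continuous g}.
Proof.
move=> E; rewrite /prop_for /continuous_at -(nbhs_singleton E).
by apply: cvg_trans; apply: near_eq_cvg; exact: E.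
Qed.

(** Openness matters because a derivative at a point of [A] sees both functions on a whole
    neighbourhood. *)
Lemma cont_diff_ext n k (A : set 'rV[R]_n) f g : open A ->
  (forall x, A x -> f x = g x) -> cont_diff k A f -> cont_diff k A g.
Proof.
move=> oA; elim: k f g => [|k IH] f g fg.
  move=> [fc _]; split=> // x /[dup] xA /set_mem Ax.
  exact: near_eq_continuous (open_near_eq oA Ax fg) (fc x xA).
move=> [fc H]; split=> [x /[dup] xA /set_mem Ax|i].
  exact: near_eq_continuous (open_near_eq oA Ax fg) (fc x xA).
have [fd fk] := H i; split=> [x Ax|].
  apply: near_eq_derivable (fd x Ax).
  exact: open_near_eq oA Ax fg.
apply: IH fk => x Ax; apply: near_eq_derive.
exact: open_near_eq oA Ax fg.
Qed.

Lemma cont_diff_differentiable n k (A : set 'rV[R]_n) f x : open A ->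
  cont_diff k.+1 A f -> A x -> differentiable f x.
Proof.
move=> oA [_ H] Ax; apply: C1_differentiable => i; have [fd fk] := H i.
  by apply: filterS (open_near oA Ax) => y; exact: fd.
exact: cont_diff_continuous fk Ax.
Qed.

Lemma cont_diff_cst n k (A : set 'rV[R]_n) c : cont_diff k A (fun=> c).
Proof.
elim: k c => [|k IH] c; first by split=> // x _; exact: cst_continuous.
split=> [x _|i]; first exact: cst_continuous.
split=> [x _|]; first exact: derivable_cst.
suff -> : 'D_(delta_mx 0 i) (fun=> c) = (fun=> 0) :> ('rV[R]_n -> R) by exact: IH.
by apply/funext => x; exact: derive_cst.
Qed.

Lemma cont_diffD n k (A : set 'rV[R]_n) f g : open A ->
  cont_diff k A f -> cont_diff k A g -> cont_diff k A (fun x => f x + g x).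
Proof.
move=> oA; elim: k f g => [|k IH] f g.
  by move=> [fc _] [gc _]; split=> // x xA; apply: continuousD; [exact: fc|exact: gc].
move=> [fc fk] [gc gk]; split=> [x xA|i].
  by apply: continuousD; [exact: fc|exact: gc].
have [fd fki] := fk i; have [gd gki] := gk i.
split=> [x Ax|]; first by apply: derivableD; [exact: fd|exact: gd].
apply: cont_diff_ext (IH _ _ fki gki) => // x Ax.
by rewrite deriveD//; [exact: fd|exact: gd].
Qed.

Lemma cont_diffM n k (A : set 'rV[R]_n) f g : open A ->
  cont_diff k A f -> cont_diff k A g -> cont_diff k A (fun x => f x * g x).
Proof.
move=> oA; elim: k f g => [|k IH] f g.
  by move=> [fc _] [gc _]; split=> // x xA; apply: continuousM; [exact: fc|exact: gc].
move=> fS gS; move: (fS) (gS) => [fc fk] [gc gk]; split=> [x xA|i].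
  by apply: continuousM; [exact: fc|exact: gc].
have [fd fki] := fk i; have [gd gki] := gk i.
split=> [x Ax|]; first by apply: derivableM; [exact: fd|exact: gd].
have H := cont_diffD oA (IH _ _ (cont_diff_lower fS) gki)
                        (IH _ _ (cont_diff_lower gS) fki).
apply: cont_diff_ext H => // x Ax.
by rewrite deriveM//; [exact: fd|exact: gd].
Qed.

Lemma cont_diff_sum n k (A : set 'rV[R]_n) (I : Type) (r : seq I) (P : pred I)
    (f : I -> 'rV[R]_n -> R) : open A ->
  (forall i, P i -> cont_diff k A (f i)) ->
  cont_diff k A (fun x => \sum_(i <- r | P i) f i x).
Proof.
move=> oA H; elim: r => [|i r IH].
  under eq_fun do rewrite big_nil; exact: cont_diff_cst.
under eq_fun do rewrite big_cons.
by case Pi: (P i) => //; apply: cont_diffD => //; exact: H.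
Qed.

Lemma cont_diff_prod n k (A : set 'rV[R]_n) (I : Type) (r : seq I) (P : pred I)
    (f : I -> 'rV[R]_n -> R) : open A ->
  (forall i, P i -> cont_diff k A (f i)) ->
  cont_diff k A (fun x => \prod_(i <- r | P i) f i x).
Proof.
move=> oA H; elim: r => [|i r IH].
  under eq_fun do rewrite big_nil; exact: cont_diff_cst.
under eq_fun do rewrite big_cons.
by case Pi: (P i) => //; apply: cont_diffM => //; exact: H.
Qed.

(** By the chain rule the partials of [g \o F] are sums of products of partials of [F] with
    functions [g' \o F], where [g'] is a partial of [g]; the induction on [k] therefore quantifies
    over [g] and keeps [F] fixed. *)
Lemma cont_diff_comp n m k (A : set 'rV[R]_n) (B : set 'rV[R]_m)
    (F : 'rV[R]_n -> 'rV[R]_m) (g : 'rV[R]_m -> R) : open A -> open B ->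
  (forall x, A x -> B (F x)) ->
  (forall j, cont_diff k A (fun x => F x 0 j)) -> cont_diff k B g ->
  cont_diff k A (g \o F).
Proof.
move=> oA oB AB; elim: k g => [|k IH] g HF Hg.
  split=> // x /set_mem Ax; apply: continuous_comp.
    by apply: continuous_rV => j; exact: cont_diff_continuous (HF j) Ax.
  exact: cont_diff_continuous Hg (AB x Ax).
have Fd x : A x -> differentiable F x.
  move=> Ax; apply: (differentiable_rV _).1 => j.
  exact: cont_diff_differentiable (HF j) Ax.
have gd x : A x -> differentiable g (F x).
  by move=> /AB; exact: cont_diff_differentiable oB Hg.
split=> [x /set_mem Ax|i].
  apply: differentiable_continuous; apply: differentiable_comp.
    exact: Fd.
  exact: gd.
have dE x : A x -> 'D_(delta_mx 0 i) (g \o F) x =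
    \sum_j 'D_(delta_mx 0 i) (fun x => F x 0 j) x * ('D_(delta_mx 0 j) g \o F) x.
  move=> Ax; rewrite deriveE; last by apply: differentiable_comp; [exact: Fd|exact: gd].
  rewrite diff_comp/=; [|exact: Fd|exact: gd].
  rewrite diff_rVE; last exact: gd.
  apply: eq_bigr => j _; rewrite -[_ *: _]/(_ * _); congr (_ * _).
  rewrite -(diff_rV_coord _ _ (Fd x Ax)) deriveE//.
  exact: cont_diff_differentiable (HF j) Ax.
split=> [x Ax|].
  by apply: diff_derivable; apply: differentiable_comp; [exact: Fd|exact: gd].
apply: cont_diff_ext (fun x Ax => esym (dE x Ax)) _ => //.
apply: cont_diff_sum => // j _; apply: cont_diffM => //.
  by have [_ /(_ i)[]] := HF j.
apply: IH => [j'|]; first exact: cont_diff_lower (HF j').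
by have [_ /(_ j)[]] := Hg.
Qed.

Lemma cont_diff_coord n k (A : set 'rV[R]_n) j : cont_diff k A (fun x => x 0 j).
Proof.
have E i x : is_derive x (delta_mx 0 i) (fun x : 'rV[R]_n => x 0 j) (i == j)%:R.
  have := @differentiable_coord R 1 n x 0 j => dc.
  split; first exact: diff_derivable.
  rewrite deriveE//.
  by rewrite diff_coord mxE eqxx eq_sym.
have C : continuous (fun x : 'rV[R]_n => x 0 j) by exact: coord_continuous.
case: k => [|k]; first by split=> // x _; exact: C.
split=> [x _|i]; first exact: C.
split=> [x _|]; first by case: (E i x).
suff -> : 'D_(delta_mx 0 i) (fun x : 'rV[R]_n => x 0 j) = (fun=> (i == j)%:R : R).
  exact: cont_diff_cst.
by apply/funext => x; case: (E i x).
Qed.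

Lemma cont_diffV n k (A : set 'rV[R]_n) f : open A ->
  (forall x, A x -> f x != 0) ->
  cont_diff k A f -> cont_diff k A (fun x => (f x)^-1).
Proof.
move=> oA f0; elim: k => [|k IH].
  by move=> [fc _]; split=> // x /[dup] xA /set_mem Ax; apply: continuousV; [exact: f0|exact: fc].
move=> fS; move: (fS) => [fc fk]; split=> [x /[dup] xA /set_mem Ax|i].
  by apply: continuousV; [exact: f0|exact: fc].
have [fd fki] := fk i.
split=> [x Ax|]; first by apply: derivableV; [exact: f0|exact: fd].
have IV := IH (cont_diff_lower fS).
have H := cont_diffM oA (cont_diff_cst k A (-1)) (cont_diffM oA (cont_diffM oA IV IV) fki).
apply: cont_diff_ext H => // x Ax.
rewrite deriveV; [|exact: f0|exact: fd].
by rewrite mulN1r scaleNr -exprVn expr2.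
Qed.

Lemma smooth_on_sub n (A B : set 'rV[R]_n) f :
  B `<=` A -> smooth_on A f -> smooth_on B f.
Proof. by move=> BA fs k; exact: cont_diff_sub (fs k). Qed.

Lemma smooth_on_local n (A : set 'rV[R]_n) f :
  (forall x, A x -> exists2 B : set 'rV[R]_n, B x & smooth_on B f) -> smooth_on A f.
Proof.
move=> H k; apply/cont_diffP => x /H[B Bx fs].
by apply: cont_diff_sub (fs k) => _ ->.
Qed.

Lemma smooth_on_ext n (A : set 'rV[R]_n) f g : open A ->
  (forall x, A x -> f x = g x) -> smooth_on A f -> smooth_on A g.
Proof. by move=> oA fg fs k; exact: cont_diff_ext (fs k). Qed.

Lemma smooth_on_continuous n (A : set 'rV[R]_n) f x :
  smooth_on A f -> A x -> {for x, continuous f}.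
Proof. by move=> fs; exact: cont_diff_continuous (fs 0%N). Qed.

Lemma smooth_on_differentiable n (A : set 'rV[R]_n) f x : open A ->
  smooth_on A f -> A x -> differentiable f x.
Proof. by move=> oA fs; exact: cont_diff_differentiable (fs 1%N). Qed.

Lemma smooth_on_derive n (A : set 'rV[R]_n) f i :
  smooth_on A f -> smooth_on A ('D_(delta_mx 0 i) f).
Proof. by move=> fs k; have [_ /(_ i)[]] := fs k.+1. Qed.

Lemma smooth_on_cst n (A : set 'rV[R]_n) c : smooth_on A (fun=> c).
Proof. by move=> k; exact: cont_diff_cst. Qed.

Lemma smooth_on_coord n (A : set 'rV[R]_n) j : smooth_on A (fun x => x 0 j).
Proof. by move=> k; exact: cont_diff_coord. Qed.

Lemma smooth_onD n (A : set 'rV[R]_n) f g : open A ->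
  smooth_on A f -> smooth_on A g -> smooth_on A (fun x => f x + g x).
Proof. by move=> oA fs gs k; exact: cont_diffD. Qed.

Lemma smooth_onM n (A : set 'rV[R]_n) f g : open A ->
  smooth_on A f -> smooth_on A g -> smooth_on A (fun x => f x * g x).
Proof. by move=> oA fs gs k; exact: cont_diffM. Qed.

Lemma smooth_onB n (A : set 'rV[R]_n) f g : open A ->
  smooth_on A f -> smooth_on A g -> smooth_on A (fun x => f x - g x).
Proof.
move=> oA fs gs; apply: smooth_on_ext (smooth_onD oA fs
  (smooth_onM oA (@smooth_on_cst _ A (-1)) gs)) => // x _.
by rewrite mulN1r.
Qed.

Lemma smooth_on_sum n (A : set 'rV[R]_n) (I : Type) (r : seq I) (P : pred I)
    (f : I -> 'rV[R]_n -> R) : open A -> (forall i, P i -> smooth_on A (f i)) ->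
  smooth_on A (fun x => \sum_(i <- r | P i) f i x).
Proof. by move=> oA fs k; apply: cont_diff_sum => // i Pi; exact: fs. Qed.

Lemma smooth_on_prod n (A : set 'rV[R]_n) (I : Type) (r : seq I) (P : pred I)
    (f : I -> 'rV[R]_n -> R) : open A -> (forall i, P i -> smooth_on A (f i)) ->
  smooth_on A (fun x => \prod_(i <- r | P i) f i x).
Proof. by move=> oA fs k; apply: cont_diff_prod => // i Pi; exact: fs. Qed.

Lemma smooth_onV n (A : set 'rV[R]_n) f : open A -> (forall x, A x -> f x != 0) ->
  smooth_on A f -> smooth_on A (fun x => (f x)^-1).
Proof. by move=> oA f0 fs k; exact: cont_diffV. Qed.

Lemma smooth_on_comp n m (A : set 'rV[R]_n) (B : set 'rV[R]_m)
    (F : 'rV[R]_n -> 'rV[R]_m) (g : 'rV[R]_m -> R) : open A -> open B ->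
  (forall x, A x -> B (F x)) -> smooth_vec_on A F -> smooth_on B g ->
  smooth_on A (g \o F).
Proof.
move=> oA oB AB Fs gs k; apply: (cont_diff_comp oA oB) => // j; exact: Fs.
Qed.

Lemma smooth_vec_on_differentiable n m (A : set 'rV[R]_n) (F : 'rV[R]_n -> 'rV[R]_m) x :
  open A -> smooth_vec_on A F -> A x -> differentiable F x.
Proof.
move=> oA Fs Ax; apply: (differentiable_rV _).1 => j.
exact: smooth_on_differentiable (Fs j) Ax.
Qed.

Lemma smooth_vec_on_continuous n m (A : set 'rV[R]_n) (F : 'rV[R]_n -> 'rV[R]_m) x :
  smooth_vec_on A F -> A x -> {for x, continuous F}.
Proof.
by move=> Fs Ax; apply: continuous_rV => j; exact: smooth_on_continuous (Fs j) Ax.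
Qed.

Lemma smooth_on_affine n m (A : set 'rV[R]_n) (B : 'M[R]_(n, m)) (b : 'rV[R]_m) :
  open A -> smooth_vec_on A (fun x => x *m B + b).
Proof.
move=> oA j.
apply: (@smooth_on_ext _ _ (fun x => \sum_i x 0 i * B i j + b 0 j)) => //.
  by move=> x _; rewrite !mxE.
apply: smooth_onD => //; last exact: smooth_on_cst.
apply: smooth_on_sum => // i _; apply: smooth_onM => //.
  exact: smooth_on_coord.
exact: smooth_on_cst.
Qed.

Lemma smooth_on_det n p (A : set 'rV[R]_n) (M : 'rV[R]_n -> 'M[R]_p) : open A ->
  (forall i j, smooth_on A (fun x => M x i j)) -> smooth_on A (fun x => \det (M x)).
Proof.
move=> oA Ms; apply: smooth_on_sum => // s _; apply: smooth_onM => //.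
  exact: smooth_on_cst.
by apply: smooth_on_prod.
Qed.

(** Cramer's rule: each entry is a cofactor divided by the determinant. *)
Lemma smooth_on_invmx n p (A : set 'rV[R]_n) (M : 'rV[R]_n -> 'M[R]_p) : open A ->
  (forall x, A x -> M x \in unitmx) ->
  (forall i j, smooth_on A (fun x => M x i j)) ->
  forall i j, smooth_on A (fun x => invmx (M x) i j).
Proof.
move=> oA Mu Ms i j.
apply: (@smooth_on_ext _ _ (fun x => (\det (M x))^-1 *
    ((-1) ^+ (j + i) * \det (row' j (col' i (M x)))))) => //.
  by move=> x Ax; rewrite /invmx (Mu x Ax) !mxE.
apply: smooth_onM => //.
  apply: smooth_onV => //; last exact: smooth_on_det.
  by move=> x /Mu; rewrite unitmxE unitfE.
apply: smooth_onM => //; first exact: smooth_on_cst.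
apply: smooth_on_det => // k l.
by apply: smooth_on_ext (Ms (lift j k) (lift i l)) => // x _; rewrite !mxE.
Qed.

Lemma ball_segment n (a x y : 'rV[R]_n) r (s : R) : ball a r x -> ball a r y ->
  0 <= s <= 1 -> ball a r (s *: (x - y) + y).
Proof.
move=> xr yr /andP[s0 s1]; move: xr yr; rewrite -ball_normE /= => xr yr.
have -> : a - (s *: (x - y) + y) = s *: (a - x) + (1 - s) *: (a - y).
  by apply/rowP => k; rewrite !mxE; ring.
have [->|s_neq0] := eqVneq s 0; first by rewrite scale0r add0r subr0 scale1r.
rewrite (le_lt_trans (ler_normD _ _))// !normrZ (ger0_norm s0).
rewrite (ger0_norm (_ : 0 <= 1 - s)) ?subr_ge0//.
have -> : r = s * r + (1 - s) * r by ring.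
by rewrite ltr_leD// ?ltr_pM2l ?lt0r ?s_neq0// ler_wpM2l ?subr_ge0// ltW.
Qed.

(** The map [Phi - id] has zero derivative at [a], hence small partials on a small ball. Balls are
    convex, so the mean value theorem applies on segments, one coordinate at a time, as the sup norm
    allows. *)
Lemma near_id_lipschitz n (A : set 'rV[R]_n) (Phi : 'rV[R]_n -> 'rV[R]_n) a e :
  open A -> smooth_vec_on A Phi -> A a ->
  (forall i j, 'D_(delta_mx 0 i) (fun x => Phi x 0 j) a = (i == j)%:R) ->
  0 < e -> exists2 r, 0 < r & ball a r `<=` A /\
    forall x y, ball a r x -> ball a r y ->
      `|Phi x - Phi y - (x - y)| <= e * `|x - y|.
Proof.
move=> oA Ps Aa Pa e0.
pose f j (x : 'rV[R]_n) := Phi x 0 j - x 0 j.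
have fs j : smooth_on A (f j) by apply: smooth_onB => //; exact: smooth_on_coord.
have fa i j : 'D_(delta_mx 0 i) (f j) a = 0.
  have dP := smooth_on_differentiable oA (Ps j) Aa.
  have dc := smooth_on_differentiable oA (@smooth_on_coord _ A j) Aa.
  rewrite deriveB; [|exact: diff_derivable..].
  rewrite Pa [X in _ - X]deriveE//.
  by rewrite diff_coord mxE eqxx eq_sym subrr.
have n0 : 0 < n.+1%:R :> R by [].
have H2 : \forall x \near a, forall ij : 'I_n * 'I_n,
    `|'D_(delta_mx 0 ij.1) (f ij.2) x| <= e / n.+1%:R.
  apply: (@filter_forall _ ('I_n * 'I_n)%type (fun ij x =>
    `|'D_(delta_mx 0 ij.1) (f ij.2) x| <= e / n.+1%:R) (nbhs a)) => -[i j] /=.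
  have := smooth_on_continuous (smooth_on_derive i (fs j)) Aa.
  move=> /cvgrPdist_le /(_ (e / n.+1%:R)); rewrite divr_gt0// => /(_ isT).
  by apply: filterS => x; rewrite fa sub0r normrN.
have : \forall x \near a, A x /\ forall ij : 'I_n * 'I_n,
    `|'D_(delta_mx 0 ij.1) (f ij.2) x| <= e / n.+1%:R.
  by apply: filterS2 (open_near oA Aa) H2 => x; split.
move=> /nbhs_ballP[r /= r0 H]; exists r => //; split=> [x /H[]//|x y xr yr].
apply: normr_rV_le => [|j]; first by rewrite mulr_ge0// ltW.
have seg (s : R) : 0 <= s <= 1 -> ball a r (s *: (x - y) + y).
  exact: ball_segment.
have fd z : ball a r z -> differentiable (f j) z.
  by move=> /H[Az _]; exact: smooth_on_differentiable (fs j) Az.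
have [s sI|s sI E] := @line_MVT _ _ (f j) y (x - y).
  by apply: diff_derivable; apply: fd; exact: seg.
have -> : (Phi x - Phi y - (x - y)) 0 j = f j (x - y + y) - f j y.
  by rewrite subrK /f !mxE; ring.
rewrite E deriveE; last by apply: fd; exact: seg.
rewrite diff_rVE; last by apply: fd; exact: seg.
rewrite (le_trans (ler_norm_sum _ _ _))//.
have -> : e * `|x - y| = \sum_(k < n.+1) (e / n.+1%:R * `|x - y|).
  rewrite sumr_const card_ord -[RHS]mulr_natl [RHS]mulrA.
  by rewrite [X in _ = X * _]mulrC divfK// gt_eqF.
rewrite [leRHS]big_ord_recr/= -[leLHS]addr0 lerD//; last first.
  by rewrite mulr_ge0// divr_ge0// ltW.
apply: ler_sum => k _; rewrite normrZ mulrC ler_pM// ?normr_coord_le//.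
by have [_ /(_ (k, j))] := H _ (seg s sI).
Qed.

End SmoothCalculus.

(** * Inverse functions and submersions *)

(** The Banach fixed-point theorem below needs row vectors as a complete normed space. *)
HB.instance Definition _ (R : realType) n :=
  Complete.copy (matrix R 1 n) (matrix R 1 n).

Section InverseFunction.
Context {R : realType}.
Implicit Types n m k : nat.

(** A solution of [Phi x = y] is a fixed point of [x - (Phi x - y)], a contraction of ratio 1/2. It
    preserves the closed ball of radius [s] because [y] moves the centre by at most [s / 2] and the
    contraction adds at most another [s / 2]. *)
Lemma near_id_surj n (Phi : 'rV[R]_n -> 'rV[R]_n) x0 s y : 0 < s ->
  (forall x z, `|x0 - x| <= s -> `|x0 - z| <= s ->
     `|Phi x - Phi z - (x - z)| <= 2^-1 * `|x - z|) ->
  `|y - Phi x0| <= s / 2 -> exists2 x, `|x0 - x| <= s & Phi x = y.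
Proof.
move=> s0 PL ys; pose U := closed_ball x0 s; pose f x := x - (Phi x - y).
have UE x : U x <-> `|x0 - x| <= s by rewrite /U closed_ballE.
have x0U : U x0 by apply/UE; rewrite subrr normr0 ltW.
have fL x z : U x -> U z -> `|f x - f z| <= 2^-1 * `|x - z|.
  move=> /UE Ux /UE Uz; rewrite -normrN (le_trans _ (PL x z Ux Uz))//.
  by rewrite le_eqVlt; apply/orP; left; apply/eqP; congr `|_|;
     apply/rowP => k; rewrite /f !mxE; ring.
have fU : set_fun U U f.
  move=> x Ux; apply/UE; have := fL x0 x x0U Ux; move/UE: Ux => Ux fx.
  have -> : x0 - f x = (Phi x0 - y) + (f x0 - f x).
    by apply/rowP => k; rewrite /f !mxE; ring.
  rewrite (le_trans (ler_normD _ _))//.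
  have -> : s = s / 2 + 2^-1 * s by field.
  rewrite lerD//; first by rewrite distrC.
  by rewrite (le_trans fx)// ler_pM2l ?invr_gt0.
have h0 : 0 <= (2^-1 : R) by [].
have ctr : is_contraction (mkfun_fun fU).
  exists (NngNum h0); split => /=; first by lra.
  by move=> [x z] [/= Ux Uz]; exact: fL.
have [|x Ux E] := banach_fixed_point ctr (@closed_ball_closed _ _ _ _).
  by exists x0.
exists x; first exact/UE.
have : x = f x by exact: E.
by rewrite /f => /eqP; rewrite eq_sym -subr_eq0 addrAC subrr sub0r oppr_eq0 subr_eq0 => /eqP.
Qed.

(** On a ball where [Phi - id] has Lipschitz constant 1/2, distances satisfy
    [|x - y| <= 2 |Phi x - Phi y|]. This gives injectivity, invertible derivatives and a Lipschitz
    inverse; openness of the image comes from the fixed-point argument. *)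
Lemma inverse_function n (A : set 'rV[R]_n) (Phi : 'rV[R]_n -> 'rV[R]_n) a :
  open A -> smooth_vec_on A Phi -> A a ->
  (forall i j, 'D_(delta_mx 0 i) (fun x => Phi x 0 j) a = (i == j)%:R) ->
  exists r (Psi : 'rV[R]_n -> 'rV[R]_n),
    [/\ 0 < r, ball a r `<=` A, open (Phi @` ball a r),
        forall x, ball a r x -> Psi (Phi x) = x
      & smooth_vec_on (Phi @` ball a r) Psi].
Proof.
move=> oA Ps Aa Pa.
have h0 : 0 < (2^-1 : R) by [].
have [r r0 [rA PL]] := near_id_lipschitz oA Ps Aa Pa h0.
set W := ball a r in rA PL *.
have oW : open W by exact: ball_open.
have PE x y : W x -> W y -> `|x - y| <= 2 * `|Phi x - Phi y|.
  move=> Wx Wy; have := PL x y Wx Wy => H.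
  have : `|x - y| <= `|Phi x - Phi y| + `|Phi x - Phi y - (x - y)|.
    rewrite -[X in `|X| <= _](subKr (Phi x - Phi y)).
    exact: ler_normB.
  by lra.
have Pinj x y : W x -> W y -> Phi x = Phi y -> x = y.
  move=> Wx Wy E; apply/eqP; rewrite -subr_eq0 -normr_le0.
  by have := PE x y Wx Wy; rewrite E subrr normr0 mulr0.
have oV : open (Phi @` W).
  rewrite openE => _ [x0 Wx0 <-].
  have /nbhs_normP[s /= s0 sW] := open_near oW Wx0.
  have s20 : 0 < s / 2 by rewrite divr_gt0.
  have sub x : `|x0 - x| <= s / 2 -> W x.
    by move=> H; apply: sW => /=; apply: le_lt_trans H _; lra.
  (* The closed ball of radius [s / 2] stays inside [W], and [near_id_surj] reaches every value
     within half of that radius. *)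
  apply/nbhs_ballP; exists (s / 4) => /=; first by lra.
  move=> y; rewrite -ball_normE/= => ys.
  have [||x xs <-] := @near_id_surj _ Phi x0 (s / 2) y s20.
  - by move=> x z /sub Wx /sub Wz; exact: PL.
  - by rewrite distrC; move: ys => /ltW ys; apply: le_trans ys _; lra.
  by exists x => //; exact: sub.
pose Psi y := xget a [set x | W x /\ Phi x = y].
have PsiK x : W x -> Psi (Phi x) = x.
  by move=> Wx; rewrite /Psi; case: xgetP => [z _ [Wz] /Pinj|/(_ x)[]//]; exact.
pose J x : 'M[R]_n := \matrix_(i, j) 'D_(delta_mx 0 i) (fun x => Phi x 0 j) x.
have Pd x : W x -> differentiable Phi x.
  by move=> /rA; exact: smooth_vec_on_differentiable.
have PJ x v : W x -> 'd Phi x v = v *m J x.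
  move=> Wx; rewrite (diff_rVE _ (Pd x Wx)); apply/rowP => j; rewrite mxE summxE.
  apply: eq_bigr => i _; rewrite !mxE; congr (_ * _).
  rewrite !deriveE; [|exact: smooth_on_differentiable (Ps j) (rA _ Wx)|exact: Pd].
  by rewrite (diff_rV_coord _ _ (Pd x Wx)).
(* Along a kernel vector, a short displacement [h] would move [Phi] by at most [|h| / 4], whereas
   [PE] demands at least [|h| / 2]. *)
have Ju x : W x -> J x \in unitmx.
  move=> Wx; rewrite -row_free_unit -kermx_eq0; apply/rowV0P => v /sub_kermxP vJ.
  apply/eqP; apply: contraT => v0.
  have v0' : 0 < `|v| by rewrite normr_gt0.
  have e0 : 0 < (4^-1 : R) by rewrite invr_gt0.
  have /nbhs_normP[d /= d0 dP] : \forall h \near 0, W (h + x) /\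
      `|Phi (h + x) - Phi x - 'd Phi x h| <= 4^-1 * `|h|.
    apply: filterS2 (differentiable_eps (Pd x Wx) e0) (_ : \forall h \near 0, W (h + x)).
      by move=> h; split.
    have /nbhs_normP[d /= d0 dW] := open_near oW Wx.
    apply: filterS (nbhs0_lt d0) => h hd; apply: dW => /=.
    by rewrite opprD addrCA subrr addr0 normrN.
  pose h := (d / 2 / `|v|) *: v.
  have hn : `|h| = d / 2.
    by rewrite /h normrZ ger0_norm ?divfK ?gt_eqF// divr_ge0// ltW// divr_gt0.
  have [|Wh] := dP h; first by rewrite /= sub0r normrN hn; lra.
  rewrite PJ// /h -scalemxAl vJ scaler0 subr0 -/h => H.
  have := PE _ _ Wh Wx; rewrite addrK hn; rewrite hn in H; move=> H2.
  by exfalso; lra.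
have Psid x : W x -> differentiable Psi (Phi x) /\
    forall v, 'd Psi (Phi x) v = v *m invmx (J x).
  move=> Wx; pose L : {linear 'rV[R]_n -> 'rV[R]_n} := mulmxr (invmx (J x)).
  have [C C0 CL] := linear_lipschitz (@linear_rV_continuous _ _ _ L).
  have [|dP dE] := @differentiable_epsP _ _ _ Psi (Phi x) L (@linear_rV_continuous _ _ _ L).
    (* Here [C] is a Lipschitz constant of the inverse Jacobian and 2 one of [Psi]; the error of
       [Phi] is multiplied by both, which returns [e]. *)
    move=> e e0; have e20 : 0 < e / (2 * C) by rewrite divr_gt0// mulr_gt0.
    have /nbhs_normP[d /= d0 dP] := differentiable_eps (Pd x Wx) e20.
    have /nbhs_normP[d' /= d'0 dV] := open_near oV (ex_intro2 _ _ x Wx erefl).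
    have d20 : 0 < d / 2 by rewrite divr_gt0.
    apply: filterS2 (nbhs0_lt d20) (nbhs0_lt d'0) => k kd kd'.
    have [|z Wz zE] := dV (k + Phi x).
      by rewrite /= opprD addrCA subrr addr0 normrN.
    rewrite -zE !PsiK//.
    have kE : k = Phi z - Phi x by rewrite zE addrK.
    pose h := z - x; have hE : z = h + x by rewrite subrK.
    have hk : `|h| <= 2 * `|k| by rewrite kE; exact: PE.
    have /dP : `|0 - h| < d by rewrite sub0r normrN; lra.
    rewrite -hE -kE PJ// => H.
    have -> : z - x - L k = L (- (k - h *m J x)).
      rewrite /L/= mulNmx mulmxBl -mulmxA mulmxV ?Ju// mulmx1 opprB.
      by [].
    rewrite (le_trans (CL _))// normrN.
    rewrite (le_trans (ler_wpM2l (ltW C0) H))//.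
    have -> : C * (e / (2 * C) * `|h|) = e / 2 * `|h| by field; rewrite gt_eqF.
    have e2 : 0 <= e / 2 by rewrite divr_ge0// ltW.
    by rewrite (le_trans (ler_wpM2l e2 hk))// mulrA divfK.
  by split => // v; rewrite dE.
(* The partial derivatives of F \o Psi are again of the form G \o Psi with G
   smooth, so the induction on k needs only the differentiability of Psi. *)
have PsiS k F : smooth_on W F -> cont_diff k (Phi @` W) (F \o Psi).
  elim: k F => [|k IH] F Fs.
    split=> // _ /set_mem[x Wx <-]; apply: continuous_comp.
      by apply: differentiable_continuous; case: (Psid x Wx).
    by rewrite PsiK//; exact: smooth_on_continuous Fs Wx.
  have dF x : W x -> differentiable F (Psi (Phi x)).
    by move=> Wx; rewrite PsiK//; exact: smooth_on_differentiable Fs Wx.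
  have dFP x : W x -> differentiable (F \o Psi) (Phi x).
    move=> Wx; apply: differentiable_comp; [by case: (Psid x Wx)|exact: dF].
  split=> [_ /set_mem[x Wx <-]|i].
    by apply: differentiable_continuous; exact: dFP.
  split=> [_ [x Wx <-]|]; first by apply: diff_derivable; exact: dFP.
  apply: (@cont_diff_ext _ _ _ _ ((fun x => \sum_j invmx (J x) i j *
      'D_(delta_mx 0 j) F x) \o Psi)) => //.
    move=> _ [x Wx <-]; rewrite [RHS]deriveE; last exact: dFP.
    have [Pd1 Pd2] := Psid x Wx.
    rewrite diff_comp//=; last exact: dF.
    rewrite diff_rVE; last exact: dF.
    apply: eq_bigr => j _; rewrite -[RHS]/(_ * _); congr (_ * _).
    by rewrite Pd2 -rowE mxE PsiK.
  apply: IH; apply: smooth_on_sum => // j _; apply: smooth_onM => //.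
    apply: smooth_on_invmx => // k1 k2.
    apply: (@smooth_on_ext _ _ _ ('D_(delta_mx 0 k1) (fun x => Phi x 0 k2))) => //.
      by move=> x _; rewrite mxE.
    by apply: smooth_on_derive; exact: smooth_on_sub (Ps k2).
  exact: smooth_on_derive.
exists r, Psi; split => // j k.
exact: (PsiS k (fun x => x 0 j) (@smooth_on_coord _ _ _ j)).
Qed.

Lemma near_eq_diff (V W : normedModType R) (f g : V -> W) x :
  (\forall y \near x, f y = g y) -> differentiable f x ->
  differentiable g x /\ 'd g x = 'd f x :> (V -> W).
Proof.
move=> fg df; apply: differentiable_epsP; first exact: diff_continuous.
move=> e e0; have fg0 : \forall h \near 0, f (h + x) = g (h + x).
  move: fg => /nbhs_normP[d /= d0 H]; apply: filterS (nbhs0_lt d0) => h hd.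
  by apply: H; rewrite /= opprD addrCA subrr addr0 normrN.
apply: filterS2 fg0 (differentiable_eps df e0) => h <-.
by rewrite (nbhs_singleton fg).
Qed.

Lemma sum_sqr_norm n (v : 'rV[R]_n) : `|v| ^+ 2 <= \sum_i v 0 i ^+ 2.
Proof.
have [v0|/mx_norm_neq0[[i j]]] := eqVneq (mx_norm v) 0.
  rewrite [`|v|]v0 expr0n/=; apply: sumr_ge0 => i _; exact: sqr_ge0.
rewrite /= ord1 => vE; rewrite [`|v|]vE real_normK ?num_real//.
by rewrite (bigD1 j)//= lerDl; apply: sumr_ge0 => k _; exact: sqr_ge0.
Qed.

(* G is half the gradient of q. Its derivative at b is the identity, so that G is
   monotone near b. *)
Lemma quasiconvex_near n (V : set 'rV[R]_n) (q : 'rV[R]_n -> R)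
    (G : 'rV[R]_n -> 'rV[R]_n) b : open V -> V b -> smooth_vec_on V G ->
  (forall y, V y -> differentiable q y /\
     forall v, 'd q y v = 2 * \sum_i v 0 i * G y 0 i) ->
  (forall i j, 'D_(delta_mx 0 i) (fun y => G y 0 j) b = (i == j)%:R) ->
  exists2 r, 0 < r & ball b r `<=` V /\ forall (y z : 'rV[R]_n) (s : R), ball b r y -> ball b r z ->
    0 <= s <= 1 -> q (s *: (z - y) + y) <= Num.max (q y) (q z).
Proof.
move=> oV Vb Gs qG Gb.
(* With this constant, the [n] error terms measured in the sup norm add up to at most
   [(s2 - s1) |v|^2], which the main term [(s2 - s1)] times the sum of the squares of [v]
   absorbs. *)
have e0 : 0 < n.+1%:R^-1 :> R by rewrite invr_gt0.
have [r r0 [rV GL]] := near_id_lipschitz oV Gs Vb Gb e0.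
exists r => //; split=> // y z s yr zr sI.
set v := z - y; have seg (t : R) : 0 <= t <= 1 -> ball b r (t *: v + y).
  exact: ball_segment.
pose h (t : R) : R := 'd q (t *: v + y) v.
have Vseg (t : R) : 0 <= t <= 1 -> V (t *: v + y) by move=> /seg /rV.
have hE (t : R) : 0 <= t <= 1 -> h t = 2 * \sum_i v 0 i * G (t *: v + y) 0 i.
  by move=> /Vseg /qG[_ /(_ v)].
have hmono (s1 s2 : R) : 0 <= s1 <= 1 -> 0 <= s2 <= 1 -> s1 <= s2 -> h s1 <= h s2.
  move=> s1I s2I s12.
  rewrite !hE//.
  rewrite ler_pM2l// -subr_ge0 -sumrB.
  pose rho := G (s2 *: v + y) - G (s1 *: v + y) - (s2 *: v + y - (s1 *: v + y)).
  have rhoL : `|rho| <= n.+1%:R^-1 * ((s2 - s1) * `|v|).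
    rewrite (le_trans (GL _ _ (seg s2 s2I) (seg s1 s1I)))//.
    by rewrite ler_pM2l// opprD addrACA subrr addr0 -scalerBl normrZ ger0_norm// subr_ge0.
  have -> : \sum_i (v 0 i * G (s2 *: v + y) 0 i - v 0 i * G (s1 *: v + y) 0 i) =
      (s2 - s1) * (\sum_i v 0 i ^+ 2) + \sum_i v 0 i * rho 0 i.
    rewrite mulr_sumr -big_split/=; apply: eq_bigr => i _.
    by rewrite /rho !mxE; ring.
  have H1 : `|\sum_i v 0 i * rho 0 i| <= (s2 - s1) * `|v| ^+ 2.
    rewrite (le_trans (ler_norm_sum _ _ _))//.
    have -> : (s2 - s1) * `|v| ^+ 2 =
        \sum_(k < n.+1) (`|v| * (n.+1%:R^-1 * ((s2 - s1) * `|v|))).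
      rewrite sumr_const card_ord -[RHS]mulr_natl; field.
      by rewrite gt_eqF// addrC natr1.
    rewrite [leRHS]big_ord_recr/= -[leLHS]addr0 lerD//; last first.
      by rewrite mulr_ge0// mulr_ge0 ?(ltW e0)// mulr_ge0// subr_ge0.
    apply: ler_sum => i _; rewrite normrM ler_pM ?normr_coord_le//.
    by rewrite (le_trans (normr_coord_le _ _)).
  have H2 : (s2 - s1) * `|v| ^+ 2 <= (s2 - s1) * \sum_i v 0 i ^+ 2.
    by rewrite ler_wpM2l ?subr_ge0//; exact: sum_sqr_norm.
  move: H1; rewrite ler_norml => /andP[H1 _].
  by rewrite -lerBlDr sub0r; lra.
(* A value above both endpoints would force, by the mean value theorem, a positive slope before it
   and a negative slope after it, against the monotonicity of [h]. *)
rewrite leNgt; apply/negP; rewrite gt_max => /andP[qy qz].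
move: sI => /andP[s0 s1].
have dq (t : R) u : 0 <= t <= 1 -> derivable q (t *: v + y) u.
  by move=> tI; apply: diff_derivable; case: (qG _ (Vseg t tI)).
have dqE (t c : R) : 0 <= t <= 1 -> 'D_(c *: v) q (t *: v + y) = c * h t.
  move=> tI; rewrite deriveE; last by case: (qG _ (Vseg t tI)).
  by rewrite linearZ.
have tI1 (t : R) : 0 <= t <= 1 -> 0 <= t * s <= 1.
  by move=> /andP[t0 t1]; rewrite mulr_ge0//= mulr_ile1.
have [t tI|t1 t1I E1] := @line_MVT _ _ q y (s *: v).
  by rewrite scalerA; exact/dq/tI1.
have tI2 (t : R) : 0 <= t <= 1 -> 0 <= t * (1 - s) + s <= 1.
  move=> /andP[t0 t1']; apply/andP; split; first by rewrite addr_ge0// mulr_ge0// subr_ge0.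
  by rewrite -lerBrDr ler_piMl// subr_ge0.
have [t tI|t2 t2I E2] := @line_MVT _ _ q (s *: v + y) ((1 - s) *: v).
  by rewrite scalerA addrA -scalerDl; exact/dq/tI2.
move: E1; rewrite scalerA dqE; last exact: tI1.
move: E2; rewrite scalerA !addrA -!scalerDl subrK scale1r subrK dqE; last exact: tI2.
have := hmono _ _ (tI1 _ t1I) (tI2 _ t2I) => hm E2 E1.
have h1 : 0 < h (t1 * s).
  rewrite ltNge; apply/negP => hn.
  have : q (s *: v + y) - q y > 0 by rewrite subr_gt0.
  by rewrite E1 ltNge mulr_ge0_le0.
have h2 : h (t2 * (1 - s) + s) < 0.
  rewrite ltNge; apply/negP => hn.
  have : q z - q (s *: v + y) < 0 by rewrite subr_lt0.
  by rewrite E2 ltNge mulr_ge0// subr_ge0.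
have : h (t1 * s) <= h (t2 * (1 - s) + s).
  apply: hm; move: t1I t2I => /andP[? ?] /andP[? ?].
  apply: (@le_trans _ _ s); first by rewrite ler_piMl.
  by rewrite lerDr mulr_ge0// subr_ge0.
by rewrite leNgt (lt_trans h2 h1).
Qed.

(* For a right inverse S of the derivative D of f at a, the map
   Phi x = x (1 - D S) + f x S has derivative 1 at a, and in the chart Phi the
   function f becomes the linear map D. *)
Lemma submersion_straighten n p (A : set 'rV[R]_n) (f : 'rV[R]_n -> 'rV[R]_p) a :
  open A -> smooth_vec_on A f -> A a -> (forall v, exists u, 'd f a u = v) ->
  exists (Phi : 'rV[R]_n -> 'rV[R]_n) (D : 'M[R]_(n, p)) (S : 'M[R]_(p, n)),
    [/\ S *m D = 1%:M, smooth_vec_on A Phi, forall x, Phi x *m D = f x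
      & forall i j, 'D_(delta_mx 0 i) (fun x => Phi x 0 j) a = (i == j)%:R].
Proof.
move=> oA fs Aa surj.
have fd := smooth_vec_on_differentiable oA fs Aa.
pose D := lin1_mx ('d f a).
have DE v : 'd f a v = v *m D by rewrite mul_rV_lin1.
have [s sE] := choice (fun i : 'I_p => surj (delta_mx 0 i)).
pose S := \matrix_i s i.
have SD : S *m D = 1%:M.
  by apply/row_matrixP => i; rewrite row_mul rowK -DE sE row1.
pose Phi x := x *m (1%:M - D *m S) + f x *m S.
have fSs : smooth_vec_on A (fun x => f x *m S).
  move=> j; apply: (@smooth_on_ext _ _ _ (fun x => \sum_i f x 0 i * S i j)) => //.
    by move=> x _; rewrite mxE.
  apply: smooth_on_sum => // i _; apply: (smooth_onM oA (fs i)).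
  exact: smooth_on_cst.
have Ps : smooth_vec_on A Phi.
  move=> j; apply: (@smooth_on_ext _ _ _
      (fun x => (x *m (1%:M - D *m S) + 0) 0 j + (f x *m S) 0 j)) => //.
    by move=> x _; rewrite addr0 [RHS]mxE.
  exact: (smooth_onD oA (smooth_on_affine _ _ oA j) (fSs j)).
have Pd := smooth_vec_on_differentiable oA Ps Aa.
(* Since [S D = 1], the factor [(1 - D S) D] vanishes, so that only [f x S D = f x] survives. *)
exists Phi, D, S; split => // [x|i j].
  rewrite mulmxDl -!mulmxA mulmxBl mul1mx -mulmxA SD !mulmx1 subrr mulmx0 add0r.
  by [].
have PE v : 'd Phi a v = v.
  pose L : {linear 'rV[R]_p -> 'rV[R]_n} := mulmxr S.
  have [C C0 CL] := linear_lipschitz (@linear_rV_continuous _ _ _ L).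
  have [|_ ->//] := @differentiable_epsP _ _ _ Phi a idfun (fun x => cvg_id).
  move=> e e0; have e1 : 0 < e / C by rewrite divr_gt0.
  apply: filterS (differentiable_eps fd e1) => h H.
  have -> : Phi (h + a) - Phi a - h = L (f (h + a) - f a - 'd f a h).
    rewrite DE /L/= !mulmxBl /Phi mulmxDl mulmxBr mulmx1 -mulmxA.
    by apply/rowP => k; rewrite !mxE; ring.
  rewrite (le_trans (CL _))// (le_trans (ler_wpM2l (ltW C0) H))//.
  by rewrite mulrA mulrCA mulfV ?mulr1// gt_eqF.
rewrite deriveE; last exact: smooth_on_differentiable (Ps j) Aa.
by rewrite diff_rV_coord// PE mxE eqxx eq_sym.
Qed.

(** In the straightening chart [f] is the linear map [D], whose right inverse [S] provides affine
    sections. The translation in [g] makes the section pass through [Phi a], and it lies in the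
    kernel of [D], so [g] is still a section. *)
Lemma local_section n p (A : set 'rV[R]_n) (f : 'rV[R]_n -> 'rV[R]_p) a :
  open A -> smooth_vec_on A f -> A a -> (forall v, exists u, 'd f a u = v) ->
  exists (V : set 'rV[R]_p) (s : 'rV[R]_p -> 'rV[R]_n),
    [/\ open V, V (f a), smooth_vec_on V s, s (f a) = a
      & forall y, V y -> A (s y) /\ f (s y) = y].
Proof.
move=> oA fs Aa surj.
have [Phi [D [S [SD Ps PD Pa]]]] := submersion_straighten oA fs Aa surj.
have [r [Psi [r0 rA oV PK Psis]]] := inverse_function oA Ps Aa Pa.
set W := Phi @` ball a r in oV Psis.
pose g y := y *m S + (Phi a - f a *m S).
have gs B : open B -> smooth_vec_on B g by move=> oB; exact: smooth_on_affine.
have gfa : g (f a) = Phi a by rewrite /g addrC subrK.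
have oG : open (g @^-1` W).
  apply: open_comp => // y _.
  by apply: (@smooth_vec_on_continuous _ _ _ setT) => //; apply: gs; exact: openT.
exists (g @^-1` W), (Psi \o g); split => //=.
- by rewrite /preimage/= gfa; exists a => //; exact: ballxx.
- move=> j; apply: (@smooth_on_comp _ _ _ _ W g (fun x => Psi x 0 j)) => //.
  exact: gs.
- by rewrite gfa PK//; exact: ballxx.
move=> y [x xr xE]; rewrite -xE PK//; split; first exact: rA.
rewrite -PD xE /g mulmxDl mulmxBl -mulmxA SD mulmx1 PD -mulmxA SD mulmx1 subrr addr0.
by [].
Qed.

(* e is the squared radius; the norm of 'rV[R]_n is the sup norm, whose balls are
   not strictly convex. *)
Definition eball n (a : 'rV[R]_n) (e : R) : set 'rV[R]_n :=
  [set x | \sum_i (x 0 i - a 0 i) ^+ 2 < e].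

Lemma smooth_sqr_dist n (a : 'rV[R]_n) (A : set 'rV[R]_n) : open A ->
  smooth_on A (fun x => \sum_i (x 0 i - a 0 i) ^+ 2).
Proof.
move=> oA; apply: smooth_on_sum => // i _.
have H : smooth_on A (fun x => x 0 i - a 0 i).
  by apply: smooth_onB => //; [exact: smooth_on_coord|exact: smooth_on_cst].
by apply: smooth_on_ext (smooth_onM oA H H) => // x _; rewrite expr2.
Qed.

Lemma is_derive_sqr_dist n (a x v : 'rV[R]_n) :
  is_derive x v (fun x => \sum_i (x 0 i - a 0 i) ^+ 2)
    (2 * \sum_i v 0 i * (x 0 i - a 0 i)).
Proof.
pose h (i : 'I_n) (x : 'rV[R]_n) := (x 0 i - a 0 i) ^+ 2.
have D i : is_derive x v (h i) (2 * (v 0 i * (x 0 i - a 0 i))).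
  pose c (x : 'rV[R]_n) := x 0 i.
  have cd : differentiable c x by exact: differentiable_coord.
  have cD : is_derive x v c (v 0 i).
    split; first exact: diff_derivable.
    by rewrite deriveE// diff_coord.
  have cD2 : is_derive x v (c - cst (a 0 i)) (v 0 i - 0) by exact: is_deriveB.
  have -> : h i = (c - cst (a 0 i)) * (c - cst (a 0 i)).
    by apply/funext => y; rewrite /h expr2.
  apply: is_derive_eq (is_deriveM cD2 cD2) _.
  rewrite subr0 -![_ *: _]/(_ * _) /c -[(_ - _) x]/(x 0 i - a 0 i).
  by ring.
have -> : (fun x : 'rV[R]_n => \sum_i (x 0 i - a 0 i) ^+ 2) = \sum_(i < n) h i.
  by apply/funext => y; rewrite fct_sumE.
by apply: is_derive_eq (is_derive_sum D) _; rewrite mulr_sumr.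
Qed.

Lemma open_eball n (a : 'rV[R]_n) e : open (eball a e).
Proof.
rewrite /eball -[X in open X]/((fun x : 'rV[R]_n =>
  \sum_i (x 0 i - a 0 i) ^+ 2) @^-1` [set y | y < e]).
apply: open_comp; last exact: open_lt.
move=> x _; apply: (@smooth_on_continuous _ _ setT) => //.
by apply: smooth_sqr_dist; exact: openT.
Qed.

Lemma eball_center n (a : 'rV[R]_n) e : 0 < e -> eball a e a.
Proof.
by move=> e0; rewrite /eball/= big1// => i _; rewrite subrr expr0n.
Qed.

Lemma sub_eball_ball n (a : 'rV[R]_n) r : 0 < r -> eball a (r ^+ 2) `<=` ball a r.
Proof.
move=> r0 x; rewrite /eball/= -ball_normE/= => H.
have r0' := ltW r0; rewrite distrC -(ltr_pXn2r (ltn0Sn 1)) ?nnegrE//.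
apply: le_lt_trans H; apply: le_trans (sum_sqr_norm _) _.
by apply: ler_sum => i _; rewrite !mxE.
Qed.

Lemma diff_compE (U V W : normedModType R) (f : U -> V) (g : V -> W) x v :
  differentiable f x -> differentiable g (f x) ->
  'd (g \o f) x v = 'd g (f x) ('d f x v).
Proof. by move=> df dg; rewrite diff_comp. Qed.

(* In the straightening chart the squared distance to a is quasiconvex, so that
   the image of a small ball is convex, and the fibres of f are affine: g is the
   preimage of a segment. *)
Lemma connected_fibres_eball n p (A : set 'rV[R]_n) (f : 'rV[R]_n -> 'rV[R]_p) a :
  open A -> smooth_vec_on A f -> A a -> (forall v, exists u, 'd f a u = v) ->
  exists2 e0, 0 < e0 & forall e, 0 < e <= e0 -> eball a e `<=` A /\
    forall x y, eball a e x -> eball a e y -> f x = f y ->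
    exists g : R -> 'rV[R]_n, [/\ g 0 = x, g 1 = y &
      forall s : R, 0 <= s <= 1 ->
        [/\ differentiable g s, eball a e (g s) & f (g s) = f x]].
Proof.
move=> oA fs Aa surj.
have [Phi [D [S [SD Ps PD Pa]]]] := submersion_straighten oA fs Aa surj.
have [r [Psi [r0 rA oV PK Psis]]] := inverse_function oA Ps Aa Pa.
have ra : ball a r a by exact: ballxx.
have oB : open (ball a r) by exact: ball_open.
set V := Phi @` ball a r in oV Psis; set b := Phi a.
have Vb : V b by exists a.
pose dd (x : 'rV[R]_n) : R := \sum_i (x 0 i - a 0 i) ^+ 2.
have Psid y : V y -> differentiable Psi y by exact: smooth_vec_on_differentiable.
have dPsi v : 'd Psi b v = v.
  have Phd : differentiable Phi a := smooth_vec_on_differentiable oA Ps Aa.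
  have dPhi u : 'd Phi a u = u.
    rewrite (diff_rVE _ Phd) [RHS]row_sum_delta; apply: eq_bigr => i _; congr (_ *: _).
    apply/rowP => j; rewrite deriveE// -(diff_rV_coord _ _ Phd) -deriveE.
      by rewrite Pa mxE eqxx eq_sym.
    exact: smooth_on_differentiable (Ps j) Aa.
  have E : \forall x \near (a : 'rV[R]_n), id x = (Psi \o Phi) x.
    have := open_near oB ra.
    by apply: filterS => x xr /=; rewrite PK.
  have [_ E'] := near_eq_diff E (@ex_diff _ _ _ _ _ _ _ (is_diff_id a)).
  have E2 : 'd (Psi \o Phi) a v = v by rewrite E' diff_val.
  have E3 := diff_compE v Phd (Psid _ Vb).
  exact: etrans (etrans (congr1 ('d Psi b) (esym (dPhi v))) (esym E3)) E2.
have Psib : Psi b = a by rewrite PK.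
(* Half of the [j]-th partial derivative of the squared distance read through [Psi]. *)
pose Gj j y := \sum_i (Psi y 0 i - a 0 i) * 'D_(delta_mx 0 j) (fun y : 'rV[R]_n => Psi y 0 i) y.
have dPs j i : smooth_on V ('D_(delta_mx 0 j) (fun y : 'rV[R]_n => Psi y 0 i)).
  by apply: smooth_on_derive; exact: Psis.
have Psa i : smooth_on V (fun y : 'rV[R]_n => Psi y 0 i - a 0 i).
  exact: (smooth_onB oV (Psis i) (smooth_on_cst _ _)).
pose G y : 'rV[R]_n := \row_j Gj j y.
have Gs : smooth_vec_on V G.
  move=> j; apply: (@smooth_on_ext _ _ _ (Gj j)) => //.
    by move=> y _; rewrite mxE.
  apply: smooth_on_sum => // i _; exact: (smooth_onM oV (Psa i) (dPs j i)).
have ddd x : differentiable dd x.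
  apply: (@smooth_on_differentiable _ _ setT) => //; first exact: openT.
  by apply: smooth_sqr_dist; exact: openT.
have qG y : V y -> differentiable (dd \o Psi) y /\
     forall v, 'd (dd \o Psi) y v = 2 * \sum_i v 0 i * G y 0 i.
  move=> Vy; split; first by apply: differentiable_comp; [exact: Psid|exact: ddd].
  move=> v; rewrite (diff_compE v (Psid y Vy) (ddd _)).
  rewrite -deriveE; last exact: ddd.
  have [_ ->] := is_derive_sqr_dist a (Psi y) ('d Psi y v).
  congr (2 * _); rewrite (diff_rVE _ (Psid y Vy)).
  under eq_bigr do rewrite summxE mulr_suml.
  rewrite exchange_big/=; apply: eq_bigr => j _; rewrite mxE mulr_sumr.
  apply: eq_bigr => i _; rewrite mxE -mulrA; congr (_ * _); rewrite mulrC; congr (_ * _).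
  rewrite deriveE; last exact: Psid.
  rewrite -(diff_rV_coord _ _ (Psid y Vy)) deriveE//.
  exact: smooth_on_differentiable (Psis i) Vy.
(* At [b] the factor [Psi y - a] vanishes, which removes the second derivatives of [Psi]; the
   remaining products of first derivatives sum to the identity because [Psi] has derivative 1 at
   [b]. *)
have Gb i j : 'D_(delta_mx 0 i) (fun y : 'rV[R]_n => G y 0 j) b = (i == j)%:R.
  pose h (k : 'I_n) (y : 'rV[R]_n) : R :=
    (Psi y 0 k - a 0 k) * 'D_(delta_mx 0 j) (fun y : 'rV[R]_n => Psi y 0 k) y.
  have -> : (fun y : 'rV[R]_n => G y 0 j) = \sum_(k < n) h k.
    by apply/funext => y; rewrite fct_sumE mxE.
  have dP (k l : 'I_n) : 'D_(delta_mx 0 k) (fun y : 'rV[R]_n => Psi y 0 l) b = (k == l)%:R.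
    rewrite deriveE; last exact: smooth_on_differentiable (Psis l) Vb.
    by rewrite diff_rV_coord ?dPsi ?mxE ?eqxx 1?eq_sym//; exact: Psid.
  have D1 (k : 'I_n) : is_derive b (delta_mx 0 i) (h k) ((i == k)%:R * (j == k)%:R).
    have Ed : is_derive b (delta_mx 0 i) (fun y : 'rV[R]_n => Psi y 0 k - a 0 k) (i == k)%:R.
      have H : is_derive b (delta_mx 0 i) (fun y : 'rV[R]_n => Psi y 0 k) (i == k)%:R.
        split; last exact: dP.
        by apply: diff_derivable; exact: smooth_on_differentiable (Psis k) Vb.
      have := @is_deriveB _ _ _ _ _ _ _ _ _ H (is_derive_cst (a 0 k) b (delta_mx 0 i)).
      by rewrite subr0.
    have Ed2 : derivable ('D_(delta_mx 0 j) (fun y : 'rV[R]_n => Psi y 0 k)) b (delta_mx 0 i).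
      by apply: diff_derivable; exact: smooth_on_differentiable (dPs j k) Vb.
    apply: is_derive_eq (is_deriveM Ed (derivableP Ed2)) _.
    rewrite Psib subrr scale0r add0r dP -[LHS]/(_ * _) mulrC.
    by [].
  have [_ ->] := is_derive_sum D1.
  rewrite (bigD1 i)//= eqxx mul1r big1 ?addr0 1?eq_sym// => k /negbTE ki.
  by rewrite eq_sym ki mul0r.
have [r2 r20 [r2V qc]] := quasiconvex_near oV Vb Gs qG Gb.
have Phc : {for a, continuous Phi} by exact: smooth_vec_on_continuous Ps Aa.
have : \forall x \near a, ball a r x /\ ball b r2 (Phi x).
  apply: filterS2 (open_near oB ra) (Phc _ (nbhsx_ballx b r2 r20)) => x.
  by split.
move=> /nbhs_ballP[r3 /= r30 H]; exists (r3 ^+ 2); first by rewrite exprn_gt0.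
move=> e /andP[e0 er3].
have sub x : eball a e x -> ball a r x /\ ball b r2 (Phi x).
  move=> xe; apply: H; apply: sub_eball_ball => //.
  by apply: lt_le_trans er3.
split=> [x /sub[/rA]//|x y xe ye fxy].
have [xr xb] := sub _ xe; have [yr yb] := sub _ ye.
pose l (s : R) := s *: (Phi y - Phi x) + Phi x.
have ld s : differentiable l s.
  apply: differentiableD => //; apply: differentiableZl; exact: ex_diff.
have lV (s : R) : 0 <= s <= 1 -> V (l s).
  by move=> sI; apply: r2V; exact: ball_segment.
exists (Psi \o l); split => /=.
- by rewrite /l scale0r add0r PK.
- by rewrite /l scale1r subrK PK.
move=> s sI; have Vs := lV s sI; split.
- by apply: differentiable_comp; [exact: ld|exact: Psid].
- apply: le_lt_trans (qc _ _ _ xb yb sI) _.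
  by rewrite /= !PK// gt_max; apply/andP; split.
case: (Vs) => z zr zE; rewrite -zE PK// -PD zE.
rewrite /l mulmxDl -scalemxAl mulmxBl !PD fxy subrr scaler0 add0r.
by [].
Qed.

End InverseFunction.

(** * Bump functions *)

Section Bump.
Context {R : realType}.

(** For [k = 0] this is the usual flat function [exp(-1/t)]. The powers of [1/t] make the family
    stable under differentiation up to linear combinations, so smoothness can be proved for all [k]
    at once. *)
Definition flat (k : nat) (t : R) : R :=
  if 0 < t then (t^-1) ^+ k * expR (- t^-1) else 0.

(** With [m = k + 2] and [u = 1 / (m t)], the exponential of [1/t] is the [m]-th power of that of
    [u], hence at least [u ^+ m]. After the division by [t ^+ k] two powers of [t] remain, enough
    for a zero derivative at 0. *)
Lemma flat_le k (t : R) : 0 < t -> flat k t <= k.+2%:R ^+ k.+2 * t ^+ 2.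
Proof.
move=> t0; rewrite /flat t0; pose m := k.+2.
have m0 : 0 < m%:R :> R by rewrite ltr0n.
pose u : R := (m%:R * t)^-1.
have u0 : 0 < u by rewrite invr_gt0 mulr_gt0.
have E : expR (t^-1) = expR u ^+ m.
  by rewrite -expRM_natl /u invfM mulrA mulfV ?gt_eqF// mul1r.
have H : u ^+ m <= expR (t^-1).
  rewrite E lerXn2r ?nnegrE ?expR_ge0 ?(ltW u0)//.
  by apply: le_trans (expR_ge1Dx u); rewrite lerDr.
have H2 : expR (- t^-1) <= m%:R ^+ m * t ^+ m.
  rewrite expRN -exprMn -[leRHS]invrK lef_pV2 ?posrE ?expR_gt0 ?invr_gt0 ?exprn_gt0 ?mulr_gt0//.
  by rewrite -exprVn.
apply: le_trans (ler_wpM2l _ H2) _; first by rewrite exprn_ge0// invr_ge0 ltW.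
rewrite mulrCA ler_pM2l ?exprn_gt0// /m -addn2 exprD mulrA -exprMn mulVf ?gt_eqF//.
by rewrite expr1n mul1r.
Qed.

Lemma is_derive_flat k (t : R) :
  is_derive t 1 (flat k) (flat k.+2 t - k%:R * flat k.+1 t).
Proof.
have [t0|t0|->] := ltgtP t 0.
- rewrite /flat [0 < t]ltNge (ltW t0)/= mulr0 subrr.
  apply: (@near_eq_is_derive _ _ _ (cst 0)).
    near=> s; rewrite /flat ltNge ifF//; apply/negbF/ltW.
    by near: s; exact: lt_nbhsl.
- have t0' : t != 0 by rewrite gt_eqF.
  have D1 : is_derive t 1 (fun s : R => s^-1) (- t ^- 2).
    split; first by apply: derivableV => //; exact: derivable_id.
    by rewrite deriveV// derive_id [_ *: _]mulr1.
  have D2 := is_deriveX k D1.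
  have D3 := @is_derive1_comp _ expR (- (fun s : R => s^-1)) t _ _
    (is_derive_expR _) (is_deriveN D1).
  have D4 := is_deriveM D2 D3.
  have E : \forall s \near t,
      ((fun s : R => s^-1) ^+ k * (expR \o - (fun s : R => s^-1))) s = flat k s.
    near=> s; rewrite /flat ifT ?fctE//.
    by near: s; exact: lt_nbhsr.
  apply: is_derive_eq (near_eq_is_derive E D4) _.
  rewrite /flat t0 -![_ *: _]/(_ * _) /= -exprVn !fctE.
  move: (expR (- t^-1)) (t^-1) => e u.
  case: k {D2 D4 E} => [|k] /=; first by rewrite !mul0r mulr0 addr0 subr0; ring.
  by rewrite opprK !exprS expr0; move: (u ^+ k) (k.+1%:R) => x y; ring.
(* At the origin the quadratic bound is below [e |h|] as soon as [|h| < e / C]. *)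
- rewrite /flat ltxx mulr0 subrr -/(flat k).
  have := @differentiable_epsP _ _ _ (flat k) 0 \0 (fun=> cvg_cst _).
  move=> [].
    move=> e e0; pose C : R := k.+2%:R ^+ k.+2.
    have C0 : 0 < C by rewrite exprn_gt0.
    have eC : 0 < e / C by rewrite divr_gt0.
    apply: filterS (nbhs0_lt eC) => h hC.
    rewrite addr0 [flat k 0]/flat ltxx !subr0.
    have [h0|h0] := ltP 0 h; last by rewrite /flat ltNge h0 normr0 mulr_ge0// ltW.
    rewrite ger0_norm; last by rewrite /flat h0 mulr_ge0 ?expR_ge0// exprn_ge0// invr_ge0 ltW.
    rewrite (le_trans (flat_le k h0))// -/C (gtr0_norm h0) expr2 mulrA ler_pM2r//.
    rewrite mulrC -ler_pdivlMr//; rewrite (gtr0_norm h0) in hC; exact: ltW.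
  move=> fd fE; split; first exact/derivable1_diffP.
  by rewrite deriveE// fE.
Unshelve. all: by end_near. Qed.

Lemma smooth_flat n k (A : set 'rV[R]_n) (f : 'rV[R]_n -> R) : open A ->
  smooth_on A f -> smooth_on A (fun x => flat k (f x)).
Proof.
move=> oA fs.
(* Smoothness is defined on row vectors, so the function of one real variable is moved to rows of
   length 1, where the composition lemma applies. *)
suff H : smooth_on setT (fun y : 'rV[R]_1 => flat k (y 0 0)).
  pose F x : 'rV[R]_1 := const_mx (f x).
  apply: (@smooth_on_ext _ _ _ ((fun y : 'rV[R]_1 => flat k (y 0 0)) \o F)) => //.
    by move=> x _; rewrite /F /= mxE.
  apply: (@smooth_on_comp _ _ _ _ setT) => //; first exact: openT.
  move=> j; apply: smooth_on_ext fs => // x _; by rewrite mxE.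
move=> K; elim: K k => [|K IH] k.
  split=> // y _; apply: (@continuous_comp _ _ _ (fun y : 'rV[R]_1 => y 0 0)).
    exact: coord_continuous.
  apply: differentiable_continuous; apply/derivable1_diffP.
  by case: (is_derive_flat k (y 0 0)).
have dc (y : 'rV[R]_1) : differentiable (fun y : 'rV[R]_1 => y 0 0) y.
  exact: differentiable_coord.
have df (t : R) : differentiable (flat k) t.
  by apply/derivable1_diffP; case: (is_derive_flat k t).
have dfc (y : 'rV[R]_1) : differentiable (fun y : 'rV[R]_1 => flat k (y 0 0)) y.
  by apply: (@differentiable_comp _ _ _ _ (fun y : 'rV[R]_1 => y 0 0)).
split=> [y _|i]; first exact: differentiable_continuous.
split=> [y _|]; first exact: diff_derivable.
have E y : 'D_(delta_mx 0 i) (fun y : 'rV[R]_1 => flat k (y 0 0)) y =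
    flat k.+2 (y 0 0) - k%:R * flat k.+1 (y 0 0).
  rewrite deriveE// (@diff_compE _ _ _ _ (fun y : 'rV[R]_1 => y 0 0) (flat k))//.
  have -> : 'd (fun y : 'rV[R]_1 => y 0 0) y (delta_mx 0 i) = 1.
    by rewrite diff_coord mxE ord1 !eqxx.
  by rewrite -deriveE//; case: (is_derive_flat k (y 0 0)).
apply: (cont_diff_ext openT (fun y _ => esym (E y))).
apply: cont_diffD; [exact: openT|exact: IH|].
apply: (@cont_diff_ext _ _ _ _ (fun y => - k%:R * flat k.+1 (y 0 0))).
- exact: openT.
- by move=> y _; rewrite mulNr.
by apply: cont_diffM; [exact: openT|exact: cont_diff_cst|exact: IH].
Qed.

(* The product with flat 0 (r^2 - |x - a|^2) cuts the linear form off outside a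
   ball; the cut-off is critical at a, so it only rescales the differential. *)
Lemma local_bump n (a : 'rV[R]_n) (r : R) (b : 'cV[R]_n) : 0 < r ->
  exists g : 'rV[R]_n -> R,
    [/\ smooth_on setT g, forall x, ~ ball a r x -> g x = 0
      & forall v, 'd g a v = (v *m b) 0 0].
Proof.
move=> r0; pose q (x : 'rV[R]_n) : R := r ^+ 2 - \sum_i (x 0 i - a 0 i) ^+ 2.
have qs : smooth_on setT q.
  exact: (smooth_onB openT (smooth_on_cst _ _) (smooth_sqr_dist a openT)).
pose chi x := flat 0 (q x).
have chis : smooth_on setT chi by apply: smooth_flat => //; exact: openT.
have qa : q a = r ^+ 2 by rewrite /q big1 ?subr0// => i _; rewrite subrr expr0n.
have chia : chi a != 0.
  by rewrite /chi qa /flat exprn_gt0// expr0 mul1r gt_eqF// expR_gt0.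
pose l (x : 'rV[R]_n) : R := (x *m b + (- (a *m b))) 0 0.
have ls : smooth_on setT l by exact: smooth_on_affine openT 0.
have la : l a = 0 by rewrite /l subrr mxE.
pose g x := chi x * ((chi a)^-1 * l x).
have l's : smooth_on setT (fun x => (chi a)^-1 * l x).
  exact: (smooth_onM openT (smooth_on_cst _ _) ls).
have gs : smooth_on setT g by exact: (smooth_onM openT chis l's).
exists g; split => // [x xr|v].
  rewrite /g /chi /flat ifF ?mul0r//; apply/negbTE; rewrite -leNgt /q subr_le0 leNgt.
  by apply/negP => H; apply: xr; exact: sub_eball_ball.
have dd h : smooth_on setT h -> differentiable h a.
  by move=> hs; exact: smooth_on_differentiable openT hs I.
rewrite -deriveE; last exact: dd.
have dv h : smooth_on setT h -> derivable h a v by move=> /dd; exact: diff_derivable.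
have := deriveM (dv _ chis) (dv _ l's).
rewrite la mulr0 scale0r addr0 => ->.
have -> : 'D_v (fun x => (chi a)^-1 * l x) a = (chi a)^-1 * 'D_v l a.
  exact: (deriveZ (chi a)^-1 (dv _ ls)).
rewrite -[_ *: _]/(_ * _) mulVKf//.
rewrite deriveE; last exact: dd.
rewrite (diff_rVE v (dd _ ls)) mxE; apply: eq_bigr => i _; rewrite -[_ *: _]/(_ * _); congr (_ * _).
rewrite /derive; apply: cvg_lim => //.
apply: (@cvg_near_cst _ _ (b i 0)); near=> h.
have h0 : h != 0 by near: h; exact: nbhs_dnbhs_neq.
rewrite /l /= -[_ *: _]/(_ * _) subrr [X in _ - X]mxE subr0 mulmxDl addrK.
by rewrite -scalemxAl -rowE !mxE mulKf.
Unshelve. all: by end_near. Qed.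

End Bump.

(** * Functions and maps on manifolds *)

Section Manifolds.
Context {R : realType}.

Lemma open_setI_preimage (T U : topologicalType) (A : set T) (f : T -> U) (W : set U) :
  open A -> (forall x, A x -> {for x, continuous f}) -> open W ->
  open (A `&` f @^-1` W).
Proof.
move=> oA fc oW; rewrite openE => x [Ax Wfx].
exact: filterI (open_nbhs_nbhs (conj oA Ax)) (fc x Ax _ (open_nbhs_nbhs (conj oW Wfx))).
Qed.

Lemma chart_image_open n (T : topologicalType) (c : chart R n T) (U : set T) :
  open U -> open (chart_map c @` (chart_dom c `&` U)).
Proof.
move=> oU; have cod := @chart_cod_open _ _ _ c.
have -> : chart_map c @` (chart_dom c `&` U) =
    (chart_map c @` chart_dom c) `&` (chart_inv c @^-1` U).
  apply/seteqP; split=> [_ [m [cm Um] <-]|_ [[m cm <-]]] /=.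
    by split; [exists m|rewrite chart_mapK//; exact: mem_set].
  by rewrite chart_mapK ?mem_set// => Um; exists m.
apply: open_setI_preimage => // x cx; apply: chart_inv_continuous.
exact: mem_set.
Qed.

Arguments chart_image_open {n T} c {U} _.

Lemma chart_preimage_open n (T : topologicalType) (c : chart R n T) (W : set 'rV[R]_n) :
  open W -> open (chart_dom c `&` chart_map c @^-1` W).
Proof.
move=> oW; apply: open_setI_preimage => //; first exact: chart_dom_open.
by move=> m cm; apply: chart_map_continuous; exact: mem_set.
Qed.

Lemma chart_map_inv n (T : topologicalType) (c : chart R n T) m :
  chart_dom c m -> chart_inv c (chart_map c m) = m.
Proof. by move=> cm; rewrite chart_mapK//; exact: mem_set. Qed.

(** * Smooth functions on a manifold and their differentials *)

Section Functions.
Context {n : nat} {M : manifold R n}.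
Implicit Types (U : set M) (m : M) (c : chart R n M).

Lemma smooth_fun_sub U V (f : M -> R) : V `<=` U -> smooth_fun U f -> smooth_fun V f.
Proof.
move=> VU fs c ac; apply: smooth_on_sub (fs c ac).
by move=> _ [m [cm /VU Um] <-]; exists m.
Qed.

(** Smooth transition maps carry smoothness from the preferred chart at a point to every chart of
    the atlas, so one chart per point suffices. *)
Lemma smooth_fun_local U (f : M -> R) :
  (forall m, U m -> exists W : set 'rV[R]_n,
     [/\ open W, W (chart_map (chart_at m) m) &
         smooth_on W (f \o chart_inv (chart_at m))]) ->
  smooth_fun U f.
Proof.
move=> H c ac; apply: smooth_on_local => _ [m [cm Um] <-].
have [W [oW Wm fW]] := H m Um.
set d := chart_at m in Wm fW; have ad : atlas d := atlas_chart_at m.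
have dm : chart_dom d m := mem_chart_at m.
have oC := chart_image_open c (@chart_dom_open _ _ _ d).
set C := chart_map c @` _ in oC.
have tau := atlas_compatible ac ad.
have oB := open_setI_preimage oC (fun x => smooth_vec_on_continuous tau) oW.
exists (C `&` (chart_map d \o chart_inv c) @^-1` W).
  by split; [exists m|rewrite /= chart_map_inv].
apply: (@smooth_on_ext _ _ _ ((f \o chart_inv d) \o (chart_map d \o chart_inv c))) => //.
  by move=> _ [[q [cq dq] <-] _] /=; rewrite (chart_map_inv cq) chart_map_inv.
apply: (smooth_on_comp oB oW) fW => [x []//|j].
by apply: smooth_on_sub (tau j) => x [].
Qed.

Lemma smooth_fun_differentiable U (f : M -> R) m c : open U -> smooth_fun U f -> U m ->
  atlas c -> chart_dom c m -> differentiable (f \o chart_inv c) (chart_map c m).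
Proof.
move=> oU fs Um ac cm; apply: smooth_on_differentiable (fs c ac) _.
  exact: chart_image_open.
by exists m.
Qed.

Lemma smooth_fun_chart_ext U (f g : M -> R) m c : open U -> U m ->
  (forall q, U q -> f q = g q) -> chart_dom c m ->
  \forall x \near chart_map c m, (f \o chart_inv c) x = (g \o chart_inv c) x.
Proof.
move=> oU Um fg cm; have := open_near (chart_image_open c oU).
move=> /(_ (chart_map c m)) []; first by exists m.
move=> r r0 H; exists r => // x /H [q [cq Uq] <-] /=.
by rewrite chart_map_inv// fg.
Qed.

Lemma differential_ext U (f g : M -> R) m : open U -> smooth_fun U f -> U m ->
  (forall q, U q -> f q = g q) -> differential g m = differential f m.
Proof.
move=> oU fs Um fg; have cm := mem_chart_at m.
have E := smooth_fun_chart_ext oU Um fg cm.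
by have [_] := near_eq_diff E (smooth_fun_differentiable oU fs Um (atlas_chart_at m) cm).
Qed.

End Functions.

(** * Smooth maps in charts and the chain rule *)

Section Maps.
Context {n p : nat} {M : manifold R n} {P : manifold R p}.
Implicit Types (U : set M) (m : M) (c : chart R n M).

Definition map_chart_dom (f : M -> P) c (d : chart R p P) U :=
  chart_map c @` (chart_dom c `&` (f @^-1` chart_dom d `&` U)).

Lemma open_map_chart_dom (f : M -> P) c d U : continuous f -> open U ->
  open (map_chart_dom f c d U).
Proof.
move=> fc oU; apply: chart_image_open; apply: openI => //.
apply: open_comp; last exact: chart_dom_open.
by move=> q _; exact: fc.
Qed.

Lemma smooth_map_chart (f : M -> P) c d U : smooth_map f -> atlas c -> atlas d ->
  smooth_vec_on (map_chart_dom f c d U) (chart_map d \o f \o chart_inv c).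
Proof.
move=> [fc fs] ac ad j; apply: smooth_on_sub (fs c d ac ad j).
by move=> _ [m [cm [dm _]] <-]; exists m.
Qed.

Lemma smooth_fun_pullback (f : M -> P) (g : P -> R) U (V : set P) : smooth_map f ->
  open U -> open V -> (forall m, U m -> V (f m)) -> smooth_fun V g ->
  smooth_fun U (g \o f).
Proof.
move=> fs oU oV UV gs; apply: smooth_fun_local => m Um.
set c := chart_at m; set d := chart_at (f m).
have ac : atlas c := atlas_chart_at m; have ad : atlas d := atlas_chart_at (f m).
have cm : chart_dom c m := mem_chart_at m; have dm : chart_dom d (f m) := mem_chart_at _.
have oW : open (map_chart_dom f c d U) := open_map_chart_dom fs.1 oU.
exists (map_chart_dom f c d U); split => //; first by exists m.
apply: (@smooth_on_ext _ _ _ ((g \o chart_inv d) \o (chart_map d \o f \o chart_inv c))) => //.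
  move=> _ [q [cq [dq _]] <-] /=; rewrite chart_map_inv//.
  by rewrite chart_mapK// mem_set.
apply: (smooth_on_comp oW (chart_image_open d oV)) (gs d ad).
  move=> _ [q [cq [dq Uq]] <-] /=; rewrite chart_map_inv//.
  by exists (f q) => //; split => //; exact: UV.
exact: smooth_map_chart.
Qed.

Lemma smooth_map_differentiable (f : M -> P) m c d : smooth_map f ->
  atlas c -> atlas d -> chart_dom c m -> chart_dom d (f m) ->
  differentiable (chart_map d \o f \o chart_inv c) (chart_map c m).
Proof.
move=> fs ac ad cm dm.
apply: smooth_vec_on_differentiable (smooth_map_chart setT fs ac ad) _.
  by apply: open_map_chart_dom; [exact: fs.1|exact: openT].
by exists m.
Qed.

Lemma differential_pullback (f : M -> P) (g : P -> R) m (V : set P) v :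
  smooth_map f -> open V -> smooth_fun V g -> V (f m) ->
  differential (g \o f) m v = differential g (f m) (tangent_map f m v).
Proof.
move=> fs oV gs Vfm.
set c := chart_at m; set d := chart_at (f m).
have ac : atlas c := atlas_chart_at m; have ad : atlas d := atlas_chart_at (f m).
have cm : chart_dom c m := mem_chart_at m; have dm : chart_dom d (f m) := mem_chart_at _.
have fd := smooth_map_differentiable fs ac ad cm dm.
have gd := smooth_fun_differentiable oV gs Vfm ad dm.
have fmE : (chart_map d \o f \o chart_inv c) (chart_map c m) = chart_map d (f m).
  by rewrite /= chart_map_inv.
rewrite -fmE in gd.
have E : \forall x \near chart_map c m,
    ((g \o chart_inv d) \o (chart_map d \o f \o chart_inv c)) x = (g \o f \o chart_inv c) x.
  have oW : open (map_chart_dom f c d setT) := open_map_chart_dom fs.1 openT.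
  have := open_near oW.
  move=> /(_ (chart_map c m)) []; first by exists m.
  move=> r r0 H; exists r => // _ /H [q [cq [dq _]] <-] /=.
  by rewrite chart_map_inv// chart_mapK// mem_set.
have [_ dE] := near_eq_diff E (differentiable_comp fd gd).
rewrite /differential dE (diff_compE v fd gd) /tangent_map fmE.
by [].
Qed.

End Maps.

(** * Local sections, descent and fibres of a submersion *)

Section Submersions.
Context {n p : nat} {M : manifold R n} {P : manifold R p} (f : M -> P).
Hypothesis fS : submersion f.
Implicit Types (U : set M) (m : M).

(** The point [q] records that [s y] really is the coordinate row of a point of [U]: [chart_inv] is
    total, and its values outside the image of the chart carry no meaning. *)
Lemma submersion_section U m : open U -> U m ->
  let c := chart_at m in let d := chart_at (f m) in
  exists (V : set 'rV[R]_p) (s : 'rV[R]_p -> 'rV[R]_n),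
    [/\ open V, V (chart_map d (f m)), smooth_vec_on V s
      & forall y, V y -> exists q,
          [/\ s y = chart_map c q, chart_dom c q, U q & f q = chart_inv d y]].
Proof.
move=> oU Um c d.
have ac : atlas c := atlas_chart_at m; have ad : atlas d := atlas_chart_at (f m).
have cm : chart_dom c m := mem_chart_at m; have dm : chart_dom d (f m) := mem_chart_at _.
pose F := chart_map d \o f \o chart_inv c.
have oA : open (map_chart_dom f c d U) := open_map_chart_dom fS.1.1 oU.
have Fs : smooth_vec_on _ F := smooth_map_chart U fS.1 ac ad.
have Aa : map_chart_dom f c d U (chart_map c m) by exists m.
have [V [s [oV Vm ss _ sV]]] := local_section oA Fs Aa (fS.2 m).
exists V, s; split => //; first by move: Vm; rewrite /F /= chart_map_inv.
move=> y /sV [[q [cq [dq Uq]] sq]] E; exists q; split => //.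
by rewrite -E /F /= -sq chart_map_inv// chart_map_inv.
Qed.

Lemma submersion_open U : open U -> open (f @` U).
Proof.
move=> oU; rewrite openE => _ [m Um <-].
have [V [s [oV Vm _ sV]]] := submersion_section oU Um.
set d := chart_at (f m) in Vm sV.
apply: filterS (open_nbhs_nbhs (conj (chart_preimage_open d oV) _)).
  move=> q [dq Vq]; have [m' [_ _ Um' E]] := sV _ Vq.
  by exists m' => //; rewrite E chart_map_inv.
by split => //; exact: mem_chart_at.
Qed.

(** Near each point of the image, [g] is [h] composed with a smooth local section of [f]. *)
Lemma smooth_fun_descent U (h : M -> R) (g : P -> R) : open U -> smooth_fun U h ->
  (forall m, U m -> h m = g (f m)) -> smooth_fun (f @` U) g.
Proof.
move=> oU hs hg; apply: smooth_fun_local => _ [m Um <-].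
have [V [s [oV Vm ss sV]]] := submersion_section oU Um.
set c := chart_at m in sV; set d := chart_at (f m) in Vm sV *.
exists V; split => //.
apply: (@smooth_on_ext _ _ _ ((h \o chart_inv c) \o s)) => //.
  move=> y /sV[q [sq cq Uq E]] /=; rewrite sq chart_map_inv// hg//.
  by rewrite E.
apply: (smooth_on_comp oV (chart_image_open c oU)) (hs c (atlas_chart_at m)) => //.
by move=> y /sV[q [sq cq Uq E]]; rewrite sq; exists q.
Qed.

(* The radius is arbitrary below e0, so that one ball serves for two submersions
   at once. *)
Lemma constant_on_fibres m (V : set M) : open V -> V m ->
  let c := chart_at m in
  exists2 e0, 0 < e0 & forall e, 0 < e <= e0 ->
    let U := chart_dom c `&` chart_map c @^-1` eball (chart_map c m) e in
    U `<=` V /\ forall h : M -> R, smooth_fun U h ->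
      (forall q v, U q -> tangent_map f q v = 0 -> differential h q v = 0) ->
      forall q q', U q -> U q' -> f q = f q' -> h q = h q'.
Proof.
move=> oV Vm c; set d := chart_at (f m).
have ac : atlas c := atlas_chart_at m; have ad : atlas d := atlas_chart_at (f m).
have cm : chart_dom c m := mem_chart_at m; have dm : chart_dom d (f m) := mem_chart_at _.
pose F := chart_map d \o f \o chart_inv c.
have oA : open (map_chart_dom f c d V) := open_map_chart_dom fS.1.1 oV.
have Fs : smooth_vec_on _ F := smooth_map_chart V fS.1 ac ad.
have Aa : map_chart_dom f c d V (chart_map c m) by exists m.
have [e0 e00 H] := connected_fibres_eball oA Fs Aa (fS.2 m).
exists e0 => // e eI U; have [eA path] := H e eI.
have oU : open U by apply: chart_preimage_open; exact: open_eball.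
have eballP x : eball (chart_map c m) e x -> exists q,
    [/\ U q, V q, chart_dom d (f q) & x = chart_map c q].
  by move=> /[dup] xe /eA [q [cq [dq Vq]] qx]; exists q; split => //; split => //=; rewrite qx.
have UP q : U q -> V q /\ chart_dom d (f q).
  move=> [cq /eballP [q' [[cq' _] Vq' dq' E]]].
  by have -> : q = q' by rewrite -(chart_map_inv cq) E chart_map_inv.
split=> [q /UP[]//|h hs hker q q' Uq Uq' fqq'].
have [g [g0 g1 gP]] : exists g : R -> 'rV[R]_n,
    [/\ g 0 = chart_map c q, g 1 = chart_map c q' & forall s : R, 0 <= s <= 1 ->
      [/\ differentiable g s, eball (chart_map c m) e (g s) &
          F (g s) = F (chart_map c q)]].
  apply: path; [exact: Uq.2|exact: Uq'.2|].
  by rewrite /F /= !chart_map_inv ?fqq'//; [exact: Uq'.1|exact: Uq.1].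
have gf (s : R) : 0 <= s <= 1 -> exists q_, [/\ U q_, g s = chart_map c q_ & f q_ = f q].
  move=> /gP [_ /eballP[r [Ur _ dr E]] FE]; exists r; split => //.
  move: FE; rewrite E /F /= !chart_map_inv; [|exact: Uq.1|exact: Ur.1].
  by move=> /(congr1 (chart_inv d)); rewrite !chart_map_inv//; case: (UP _ Uq).
pose k (s : R) : R := h (chart_inv c (g s)).
have kd (s : R) : 0 <= s <= 1 -> differentiable k s.
  move=> sI; have [gd _ _] := gP s sI; have [r [Ur gs _]] := gf s sI.
  apply: (@differentiable_comp _ _ _ _ g (h \o chart_inv c)) => //.
  by rewrite gs; exact: smooth_fun_differentiable oU hs Ur ac Ur.1.
have k'0 (s : R) : s \in `]0, 1[%R -> is_derive s 1 k 0.
  rewrite in_itv/= => /andP[s0 s1].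
  have sI : 0 <= s <= 1 by rewrite !ltW.
  split; first by apply: diff_derivable; exact: kd.
  rewrite deriveE; last exact: kd.
  have [gd _ _] := gP s sI; have [r [Ur gs fr]] := gf s sI.
  (* Tangent vectors at [r] are measured in the chart preferred at [r], which varies along the
     curve; the curve is therefore rewritten in [c'] near the time [s]. Its image under [f] is
     constant, so its velocity lies in the kernel to which [hker] applies. *)
  pose c' := chart_at r; pose d' := chart_at (f r).
  have ac' : atlas c' := atlas_chart_at r; have ad' : atlas d' := atlas_chart_at (f r).
  have cr : chart_dom c' r := mem_chart_at r; have dr : chart_dom d' (f r) := mem_chart_at _.
  have oC := chart_image_open c (@chart_dom_open _ _ _ c').
  have tau := atlas_compatible ac ac'.
  pose g' := (chart_map c' \o chart_inv c) \o g.
  have Cgs : (chart_map c @` (chart_dom c `&` chart_dom c')) (g s).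
    by rewrite gs; exists r => //; split => //; exact: Ur.1.
  have taud : differentiable (chart_map c' \o chart_inv c) (g s).
    exact: smooth_vec_on_differentiable oC tau Cgs.
  have g'd : differentiable g' s by exact: differentiable_comp.
  have g's : g' s = chart_map c' r.
    by rewrite /g' /= gs chart_map_inv//; exact: Ur.1.
  have near_s : \forall t \near s, [/\ 0 <= t <= 1 &
      (chart_map c @` (chart_dom c `&` chart_dom c')) (g t)].
    have gc : {for s, continuous g} by exact: differentiable_continuous.
    have H1 := gc _ (open_nbhs_nbhs (conj oC Cgs)).
    near=> t; split; last by near: t; exact: H1.
    by apply/andP; split; apply: ltW; near: t; [exact: lt_nbhsr|exact: lt_nbhsl].
  have E1 : \forall t \near s, ((h \o chart_inv c') \o g') t = k t.
    apply: filterS near_s => t [_ [r' [cr' c'r'] E]].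
    by rewrite /g' /k /= -E (chart_map_inv cr') chart_map_inv.
  have hd : differentiable (h \o chart_inv c') (g' s).
    by rewrite g's; exact: smooth_fun_differentiable oU hs Ur ac' cr.
  have [_ ->] := near_eq_diff E1 (differentiable_comp g'd hd).
  rewrite (diff_compE (1 : R) g'd hd).
  have := hker r ('d g' s 1) Ur; rewrite /differential -/c' -g's; apply.
  have Fd : differentiable (chart_map d' \o f \o chart_inv c') (g' s).
    by rewrite g's; exact: smooth_map_differentiable fS.1 ac' ad' cr dr.
  have E2 : \forall t \near s,
      cst (chart_map d' (f q)) t = ((chart_map d' \o f \o chart_inv c') \o g') t.
    apply: filterS near_s => t [tI [r' [cr' c'r'] E]].
    have [r2 [Ur2 gr2 fr2]] := gf t tI.
    have rr : r' = r2.
      by rewrite -(chart_map_inv cr') E gr2 chart_map_inv//; exact: Ur2.1.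
    by rewrite /g' /= -E (chart_map_inv cr') chart_map_inv// rr fr2.
  have [_ E3] := near_eq_diff E2 (differentiable_cst _ _).
  rewrite /tangent_map -/c' -/d' -g's -(diff_compE (1 : R) g'd Fd) E3 diff_cst.
  by [].
have kc : {within `[0, 1], continuous k}.
  apply: derivable_within_continuous => s; rewrite in_itv/= => sI.
  by apply: diff_derivable; exact: kd.
have [s _] := MVT_segment ler01 k'0 kc.
rewrite mul0r => /eqP; rewrite subr_eq0 /k g0 g1 => /eqP.
by rewrite !chart_map_inv//; [exact: Uq.1|exact: Uq'.1].
Unshelve. all: by end_near. Qed.

End Submersions.

(** A bump function in the chart at [p] is extended by zero. The column [b] holds the coefficients
    of the prescribed covector. *)
Lemma prescribed_differential n (P : manifold R n) (p : P) (b : 'cV[R]_n) :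
  exists2 g : P -> R, smooth_fun setT g &
    forall v, differential g p v = (v *m b) 0 0.
Proof.
set c := chart_at p; have ac : atlas c := atlas_chart_at p.
have cp : chart_dom c p := mem_chart_at p.
set a := chart_map c p; have ocod := @chart_cod_open _ _ _ c.
have coda : (chart_map c @` chart_dom c) a by exists p.
have /nbhs_normP[r0 /= r00 cod_r0] := open_near ocod coda.
(* Halving the radius places the closed ball, not just the open one, inside the image of the
   chart. *)
pose r := r0 / 2; have r_gt0 : 0 < r by rewrite divr_gt0.
have ball_cod y : `|a - y| <= r -> (chart_map c @` chart_dom c) y.
  by move=> ay; apply: cod_r0 => /=; apply: le_lt_trans ay _; rewrite /r; lra.
have [G [Gs G0 dG]] := local_bump a b r_gt0.
pose g q := if `[< chart_dom c q >] then G (chart_map c q) else 0.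
pose B : set 'rV[R]_n := closed_ball a r.
have BE y : B y <-> `|a - y| <= r by rewrite /B closed_ballE.
pose K := chart_inv c @` B.
have cK : compact K.
  apply: continuous_compact.
    apply: continuous_in_subspaceT => y /set_mem /BE /ball_cod cy.
    by apply: chart_inv_continuous; exact: mem_set.
  apply: bounded_closed_compact; last exact: closed_ball_closed.
  exists (`|a| + r); split; first exact: num_real.
  move=> N rN y /BE ay; apply: le_trans (ltW rN).
  have -> : y = a - (a - y) by rewrite subKr.
  by rewrite (le_trans (ler_normB _ _))// lerD2l.
(* The Hausdorff property is what makes the extension by zero smooth: the compact set [K] is closed
   in [P], so a point outside the chart domain has a neighbourhood on which [g] vanishes. *)
have clK : closed K := compact_closed (@manifold_hausdorff _ _ P) cK.
have Kdom : K `<=` chart_dom c.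
  by move=> _ [y /BE /ball_cod [m cm <-] <-]; rewrite chart_map_inv.
exists g.
  apply: smooth_fun_local => q _; set d := chart_at q.
  have ad : atlas d := atlas_chart_at q; have dq : chart_dom d q := mem_chart_at q.
  have [cq|cq] := pselect (chart_dom c q).
    have oW := chart_image_open d (@chart_dom_open _ _ _ c).
    exists (chart_map d @` (chart_dom d `&` chart_dom c)); split => //; first by exists q.
    apply: (@smooth_on_ext _ _ _ (G \o (chart_map c \o chart_inv d))) => //.
      by move=> _ [m [dm cm] <-] /=; rewrite /g chart_map_inv// asboolT.
    exact: (smooth_on_comp oW openT (fun _ _ => I) (atlas_compatible ad ac) Gs).
  have oK : open (~` K) by exact: closed_openC.
  have oW := chart_image_open d oK.
  exists (chart_map d @` (chart_dom d `&` ~` K)); split => //.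
    by exists q => //; split => // /Kdom.
  apply: (@smooth_on_ext _ _ _ (fun=> 0)) => //; last exact: smooth_on_cst.
  move=> _ [m [dm Km] <-] /=; rewrite /g chart_map_inv//.
  case: asboolP => // cm; rewrite G0// => am; apply: Km.
  exists (chart_map c m); last by rewrite chart_map_inv.
  by apply/BE; move: am; rewrite -ball_normE/= => /ltW.
move=> v; have E : \forall x \near a, G x = (g \o chart_inv c) x.
  have := open_near ocod coda; apply: filterS => _ [m cm <-] /=.
  by rewrite /g chart_map_inv// asboolT.
have Gd : differentiable G a by exact: smooth_on_differentiable openT Gs I.
have [_ dgE] := near_eq_diff E Gd.
by rewrite /differential -/c -/a dgE dG.
Qed.

(** * Hamiltonian vectors by linear algebra at a point *)

Section Symplectic.
Context {n : nat} {M : manifold R n} (w : symplectic_form M).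

Lemma form_matrix m : exists2 W : 'M[R]_n, W \in unitmx &
  forall u v, w m u v = (u *m W *m v^T) 0 0.
Proof.
pose W : 'M[R]_n := \matrix_(i, j) w m (delta_mx 0 i) (delta_mx 0 j).
have wl z : linear (fun u : 'rV[R]_n => w m u z : R^o).
  by move=> a u v; exact: form_linearl.
have wr z : linear (fun u : 'rV[R]_n => w m z u : R^o).
  by move=> a u v; exact: form_linearr.
have WE u v : w m u v = (u *m W *m v^T) 0 0.
  pose L1 : {linear 'rV[R]_n -> R^o} :=
    HB.pack (fun u : 'rV[R]_n => w m u v : R^o) (GRing.isLinear.Build _ _ _ _ _ (wl v)).
  rewrite -[LHS]/(L1 u) {1}[u]row_sum_delta linear_sum -mulmxA mxE.
  apply: eq_bigr => i _; rewrite linearZ /= -[LHS]/(_ * _); congr (_ * _).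
  pose L2 : {linear 'rV[R]_n -> R^o} := HB.pack (fun v : 'rV[R]_n =>
    w m (delta_mx 0 i) v : R^o) (GRing.isLinear.Build _ _ _ _ _ (wr (delta_mx 0 i))).
  rewrite -[LHS]/(L2 v) {1}[v]row_sum_delta linear_sum mxE.
  by apply: eq_bigr => j _; rewrite linearZ /= !mxE mulrC.
exists W => //; rewrite -row_free_unit -kermx_eq0; apply/rowV0P => u /sub_kermxP uW.
by apply: (@form_nondegenerate _ _ _ w m) => v; rewrite WE uW mul0mx mxE.
Qed.

(** The defining equation is always solvable, by the row of partial derivatives of [h] times the
    inverse matrix of the form, so the default value 0 of [xget] is never returned for want of a
    solution. *)
Lemma hamiltonianP (h : M -> R) m v : differential h m v = w m (hamiltonian w h m) v.
Proof.
rewrite /hamiltonian; case: xgetP => [X _ ->//|noX].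
have [W Wu WE] := form_matrix m.
pose D : 'rV[R]_n := \row_i differential h m (delta_mx 0 i).
exfalso; apply: (noX (D *m invmx W)) => u; rewrite WE mulmxKV// mxE.
rewrite /differential {1}[u]row_sum_delta linear_sum; apply: eq_bigr => i _.
by rewrite linearZ/= !mxE mulrC.
Qed.

Lemma hamiltonian_unique (h : M -> R) m X :
  (forall v, differential h m v = w m X v) -> hamiltonian w h m = X.
Proof.
move=> HX; apply/eqP; rewrite -subr_eq0; apply/eqP.
apply: (@form_nondegenerate _ _ _ w m) => v.
have := @form_linearl _ _ _ w m (-1) X (hamiltonian w h m) v.
by rewrite scaleN1r addrC -hamiltonianP HX mulN1r addNr.
Qed.

Lemma hamiltonian_ext (g h : M -> R) m :
  differential g m =1 differential h m -> hamiltonian w g m = hamiltonian w h m.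
Proof. by move=> gh; apply: hamiltonian_unique => v; rewrite gh hamiltonianP. Qed.

Lemma bracketE (g h : M -> R) m :
  symplectic_bracket w g h m = differential g m (hamiltonian w h m).
Proof. by rewrite hamiltonianP. Qed.

Lemma form_antisym m X Y : w m X Y = - w m Y X.
Proof.
have E1 z : w m (X + Y) z = w m X z + w m Y z.
  by have := @form_linearl _ _ _ w m 1 X Y z; rewrite scale1r mul1r.
have E2 z : w m z (X + Y) = w m z X + w m z Y.
  by have := @form_linearr _ _ _ w m 1 X Y z; rewrite scale1r mul1r.
have := form_alternating w m (X + Y).
rewrite E1 (E2 X) (E2 Y) (form_alternating w m X) (form_alternating w m Y).
by rewrite add0r addr0 => /eqP; rewrite addr_eq0 => /eqP.
Qed.

Lemma bracketC (g h : M -> R) m :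
  symplectic_bracket w g h m = - symplectic_bracket w h g m.
Proof. exact: form_antisym. Qed.

End Symplectic.

(** The level set through [x] is relatively open in [A], and relatively closed because the sets
    [O z] of the other values cover its complement in [A]. *)
Lemma locally_constant_on_connected (T : topologicalType) (U : Type) (A : set T)
    (h : T -> U) : connected A ->
  (forall x, exists B : set T, [/\ open B, B x &
     forall y, A x -> A y -> B y -> h y = h x]) ->
  forall x y, A x -> A y -> h x = h y.
Proof.
move=> cA loc x y Ax Ay.
pose O z := \bigcup_(B in [set B : set T | open B /\
  forall t, A t -> B t -> h t = h z]) B.
have oO z : open (O z) by apply: bigcup_open => B [].
have OP z t : A t -> (O z t <-> h t = h z).
  move=> At; split=> [[B [_ HB] Bt]|E]; first exact: HB.
  have [B [oB Bt HB]] := loc t.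
  by exists B => //; split=> // s As Bs; rewrite -E; exact: HB.
have E : A `&` [set t | h t = h x] = A.
  apply: cA; first by exists x.
    exists (O x) => //; apply/seteqP; split=> t /= [At] /OP H; split=> //; exact: H.
  exists (~` \bigcup_(z in [set z | h z <> h x]) O z).
    by apply: open_closedC; exact: bigcup_open.
  apply/seteqP; split=> t /= [At H]; split=> //.
    by move=> [z /= zx Ozt]; apply: zx; rewrite -((OP z t At).1 Ozt).
  by apply: contrapT => tx; apply: H; exists t => //; exact/OP.
by have [_ /= ->] : (A `&` [set t | h t = h x]) y by rewrite E.
Qed.

(** * Algebras of functions pulled back along a submersion *)

Section Pullbacks.
Context {n p : nat} {M : manifold R n} {P : manifold R p} (w : symplectic_form M).
Context (f : M -> P).
Hypothesis fS : submersion f.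
Implicit Types (U : set M) (m : M).

Lemma pullback_smooth U (h : M -> R) : open U -> pullbacks f U h -> smooth_fun U h.
Proof.
move=> oU [g gs hg].
have H : smooth_fun U (g \o f).
  by apply: (smooth_fun_pullback fS.1 oU (submersion_open fS oU) _ gs) => m Um; exists m.
move=> c ac; apply: smooth_on_ext (H c ac); first exact: chart_image_open.
by move=> _ [m [cm Um] <-] /=; rewrite chart_map_inv// hg.
Qed.

Lemma pullbacks_sub U V : U `<=` V -> pullbacks f V `<=` pullbacks f U.
Proof.
move=> UV h [g gs hg]; exists g => [|m /UV]; last exact: hg.
by apply: smooth_fun_sub gs => _ [m /UV Vm <-]; exists m.
Qed.

Lemma global_pullback (g : P -> R) U : smooth_fun setT g -> pullbacks f U (g \o f).
Proof. by move=> gs; exists g => //; exact: smooth_fun_sub gs. Qed.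

Lemma differential_pullback_local U (g : P -> R) (h : M -> R) m v : open U -> U m ->
  smooth_fun (f @` U) g -> (forall q, U q -> h q = g (f q)) ->
  differential h m v = differential g (f m) (tangent_map f m v).
Proof.
move=> oU Um gs hg.
have oV := submersion_open fS oU; have Vm : (f @` U) (f m) by exists m.
rewrite -(differential_pullback v fS.1 oV gs Vm).
have hs : smooth_fun U h by apply: pullback_smooth => //; exists g.
by rewrite (differential_ext oU hs Um hg).
Qed.

Lemma differential_global_pullback (g : P -> R) m v : smooth_fun setT g ->
  differential (g \o f) m v = differential g (f m) (tangent_map f m v).
Proof. by move=> gs; exact: (differential_pullback _ fS.1 openT gs I). Qed.

Lemma tangent_matrix m : exists2 D : 'M[R]_(n, p),
  (forall u, tangent_map f m u = u *m D) & row_full D.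
Proof.
exists (lin1_mx (tangent_map f m)) => [u|]; first by rewrite mul_rV_lin1.
have [s sE] := choice (fun i : 'I_p => fS.2 m (delta_mx 0 i)).
apply/row_fullP; exists (\matrix_i s i).
apply/row_matrixP => i; rewrite row_mul rowK mul_rV_lin1 row1; exact: sE.
Qed.

Lemma hamiltonian_pullback U (h : M -> R) m : open U -> U m -> pullbacks f U h ->
  exists2 g : P -> R, smooth_fun setT g &
    hamiltonian w h m = hamiltonian w (g \o f) m.
Proof.
move=> oU Um [g gs hg].
have [g' g's dg'] := prescribed_differential (f m)
  (\col_i differential g (f m) (delta_mx 0 i)).
exists g'; first exact: g's.
apply: hamiltonian_ext => v.
rewrite (differential_pullback_local v oU Um gs hg).
rewrite (differential_global_pullback m v g's) dg'.
rewrite /differential {1}[tangent_map f m v]row_sum_delta linear_sum mxE.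
by apply: eq_bigr => i _; rewrite linearZ/= mxE.
Qed.

End Pullbacks.

(** * Centralizers *)

Section DualPairs.
Context {n n1 n2 : nat} {M : manifold R n} (w : symplectic_form M).
Context {P1 : manifold R n1} {P2 : manifold R n2} (f1 : M -> P1) (f2 : M -> P2).
Hypotheses (f1S : submersion f1) (f2S : submersion f2).

(** Stated for global functions, since [hamiltonian_pullback] carries it over to the pullbacks on
    any open set. *)
Definition commuting_pullbacks := forall (g1 : P1 -> R) (g2 : P2 -> R),
  smooth_fun setT g1 -> smooth_fun setT g2 ->
  forall m, symplectic_bracket w (g1 \o f1) (g2 \o f2) m = 0.

(** A function on [P2] whose differential at [f2 m] is the [j]-th coordinate reads off the [j]-th
    component of the tangent vector as a bracket, which vanishes. *)
Lemma tangent_hamiltonian0 (g : P1 -> R) m : commuting_pullbacks ->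
  smooth_fun setT g -> tangent_map f2 m (hamiltonian w (g \o f1) m) = 0.
Proof.
move=> comm gs; apply/rowP => j; rewrite mxE.
have [g2 g2s dg2] := prescribed_differential (f2 m) (delta_mx j 0).
have := comm g g2 gs g2s m.
rewrite bracketC bracketE (differential_global_pullback f2S)// dg2 -colE mxE.
by move=> /eqP; rewrite oppr_eq0 => /eqP.
Qed.

(* The Hamiltonian vectors of the functions pulled back from P1 form a space of
   dimension n1 inside the kernel of the tangent map of f2, which has dimension
   n - n2. *)
Lemma kernel_hamiltonian m v : commuting_pullbacks -> (n1 + n2 = n)%N ->
  tangent_map f2 m v = 0 ->
  exists2 g : P1 -> R, smooth_fun setT g & hamiltonian w (g \o f1) m = v.
Proof.
move=> comm dimE v0.
have [W Wu WE] := form_matrix w m.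
have [D1 D1E D1f] := tangent_matrix f1S m.
have [D2 D2E D2f] := tangent_matrix f2S m.
(* The Hamiltonian vector [X] of a covector [u] pulled back by [D1] solves [X W x^T = x D1 u^T] for
   all [x], that is, [X = u D1^T W^-1]. *)
pose K := D1^T *m invmx W.
have KH (u : 'rV[R]_n1) : exists2 g : P1 -> R, smooth_fun setT g &
    hamiltonian w (g \o f1) m = u *m K.
  have [g gs dg] := prescribed_differential (f1 m) u^T.
  exists g; first exact: gs.
  apply: hamiltonian_unique => x.
  rewrite (differential_global_pullback f1S)// dg D1E WE /K !mulmxA mulmxKV//.
  have -> : u *m D1^T *m x^T = (x *m D1 *m u^T)^T by rewrite !trmx_mul trmxK mulmxA.
  by rewrite [RHS]mxE.
have KD2 : K *m D2 = 0.
  apply/row_matrixP => i; rewrite row_mul row0.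
  have [g gs gK] := KH (delta_mx 0 i).
  by rewrite rowE -gK -D2E tangent_hamiltonian0.
have rK : \rank K = n1.
  rewrite mxrankMfree; last by rewrite row_free_unit unitmx_inv.
  by rewrite mxrank_tr; apply/eqP.
have Kker : (K <= kermx D2)%MS by apply/sub_kermxP.
(* An inclusion between spaces of equal dimension [n1 = n - n2] is an equality; this is where the
   dimension count enters. *)
have kerK : (kermx D2 <= K)%MS.
  have := (mxrank_leqif_eq Kker).2; rewrite rK mxrank_ker.
  have -> : (n1 == n - \rank D2)%N by rewrite (eqP D2f) -dimE addnK.
  by move=> /esym /andP[].
have : (v <= K)%MS.
  by apply: submx_trans kerK; apply/sub_kermxP; rewrite -D2E.
by move=> /submxP [u ->]; exact: KH.
Qed.

(** The last premise is the conclusion of [constant_on_fibres]; taking it as a premise keeps the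
    algebra apart from the shape of [U]. *)
Lemma local_centralizer U : open U -> commuting_pullbacks -> (n1 + n2 = n)%N ->
  (forall h : M -> R, smooth_fun U h ->
     (forall q v, U q -> tangent_map f2 q v = 0 -> differential h q v = 0) ->
     forall q q', U q -> U q' -> f2 q = f2 q' -> h q = h q') ->
  centralizer w U (pullbacks f1 U) = pullbacks f2 U.
Proof.
move=> oU comm dimE Hconst; apply/seteqP; split=> h.
  move=> [hs hcomm].
  have hconst : forall q q', U q -> U q' -> f2 q = f2 q' -> h q = h q'.
    apply: Hconst => // q v Uq v0.
    have [g gs <-] := kernel_hamiltonian comm dimE v0.
    by rewrite -bracketE; apply: hcomm => //; exact: global_pullback.
  (* The descended function chooses points in the fibres and needs a default [q0] in [U]; on the
     empty set the zero function serves. *)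
  have [U0|[q0 Uq0]] : U = set0 \/ U !=set0.
    by have [->|/set0P] := eqVneq U set0; [left|right].
    exists (fun=> 0) => [|m]; last by rewrite U0.
    by rewrite U0 image_set0 => c _; rewrite setI0 image_set0 => k; apply/cont_diffP.
  pose g y := h (xget q0 [set q | U q /\ f2 q = y]).
  have hg q : U q -> h q = g (f2 q).
    move=> Uq; rewrite /g; case: xgetP => [r _ [Ur fr]|/(_ q)[]//].
    exact: hconst.
  by exists g => //; exact: smooth_fun_descent hg.
move=> hU; split; first exact: pullback_smooth hU.
move=> k kU m Um.
have [g gs kE] := hamiltonian_pullback w f1S oU Um kU.
have [g2 g2s hg2] := hU.
rewrite bracketE kE (differential_pullback_local f2S _ oU Um g2s hg2).
rewrite (tangent_hamiltonian0 m comm gs); exact: linear0.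
Qed.

(** Local duality turns a centralizing function into a pullback near each point, hence locally
    constant along the fibres; connectedness makes it constant on each fibre. Conversely,
    commutation at a point is read off in a neighbourhood where the duality holds. *)
Lemma global_centralizer :
  (forall m, exists U, [/\ open U, U m &
     centralizer w U (pullbacks f1 U) = pullbacks f2 U]) ->
  (forall p : P2, connected (f2 @^-1` [set p])) -> set_surj setT setT f2 ->
  centralizer w setT (pullbacks f1 setT) = pullbacks f2 setT.
Proof.
move=> loc conn surj; apply/seteqP; split=> h.
  move=> [hs hcomm].
  have hloc m : exists U, [/\ open U, U m & pullbacks f2 U h].
    have [U [oU Um UE]] := loc m; exists U; split => //.
    rewrite -UE; split; first exact: smooth_fun_sub hs.
    (* The assumption on [h] concerns global pullbacks, whereas [k] lives on [U]; at [q] they have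
       the same Hamiltonian vector. *)
    move=> k kU q Uq; have [g gs kE] := hamiltonian_pullback w f1S oU Uq kU.
    rewrite bracketE kE -(bracketE w h (g \o f1) q).
    exact: (hcomm (g \o f1) (global_pullback f1 setT gs) q I).
  have hconst q q' : f2 q = f2 q' -> h q = h q'.
    move=> E; apply: (locally_constant_on_connected (conn (f2 q))) => //.
    move=> m; have [U [oU Um [g _ hg]]] := hloc m; exists U; split => //.
    by move=> y /= mq yq Uy; rewrite !hg// mq yq.
  have preim y : exists m, f2 m = y by have [m _ mE] := surj y I; exists m.
  (* A section of [f2] without any continuity; the smoothness of [h \o s] comes from the smooth
     local sections behind [smooth_fun_descent]. *)
  have [s sE] := choice preim.
  have hg m : setT m -> h m = (h \o s) (f2 m).
    by move=> _ /=; apply: hconst; rewrite sE.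
  exists (h \o s) => //.
  exact (@smooth_fun_descent _ _ _ _ f2 f2S setT h (h \o s) openT hs hg).
move=> hT; split; first by apply: pullback_smooth hT => //; exact: openT.
move=> k kT m _; have [U [oU Um UE]] := loc m.
have : pullbacks f2 U h by apply: pullbacks_sub hT.
by rewrite -UE => -[_]; apply => //; apply: pullbacks_sub kT.
Qed.

End DualPairs.

End Manifolds.

Theorem theorem4 (R : realType) (n n1 n2 : nat)
    (M : manifold R n) (w : symplectic_form M)
    (P1 : manifold R n1) (b1 : poisson_structure P1)
    (P2 : manifold R n2) (b2 : poisson_structure P2)
    (pi1 : M -> P1) (pi2 : M -> P2)
    (poisson1 : poisson_map (symplectic_bracket w) b1 pi1)
    (poisson2 : poisson_map (symplectic_bracket w) b2 pi2)
    (submersion1 : submersion pi1) (submersion2 : submersion pi2)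
    (surjective1 : set_surj setT setT pi1)
    (surjective2 : set_surj setT setT pi2) :
  (howe_dual_pair w pi1 pi2 -> (n1 + n2 = n)%N ->
     local_howe_dual_pair w pi1 pi2) /\
  (local_howe_dual_pair w pi1 pi2 ->
     (forall p : P1, connected (pi1 @^-1` [set p])) ->
     (forall p : P2, connected (pi2 @^-1` [set p])) ->
     howe_dual_pair w pi1 pi2).
Proof.
split=> [[E1 E2] dimE m V mV|loc c1 c2].
  (* The global duality places [g1 \o pi1] in the centralizer of the functions pulled back along
     [pi2]. Maximality on [U] is then rebuilt from the dimension count. *)
  have comm12 : commuting_pullbacks w pi1 pi2.
    move=> g1 g2 g1s g2s m0.
    have : centralizer w setT (pullbacks pi2 setT) (g1 \o pi1).
      by rewrite E2; exact: global_pullback.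
    by move=> [_]; apply => //; exact: global_pullback.
  have comm21 : commuting_pullbacks w pi2 pi1.
    by move=> g2 g1 g2s g1s m0; rewrite bracketC comm12// oppr0.
  (* [V] is a neighbourhood, not necessarily open, so the ball is sought inside its interior. *)
  have oV : open V° by exact: open_interior.
  have Vm : V° m by [].
  have [e1 e10 H1] := constant_on_fibres submersion1 oV Vm.
  have [e2 e20 H2] := constant_on_fibres submersion2 oV Vm.
  pose e := Num.min e1 e2.
  have e0 : 0 < e by rewrite lt_min e10.
  have [|UV const1] := H1 e; first by rewrite e0 ge_min lexx.
  have [|_ const2] := H2 e; first by rewrite e0 ge_min lexx orbT.
  set U := _ `&` _ in UV const1 const2.
  have oU : open U by apply: chart_preimage_open; exact: open_eball.
  exists U; split => //.
  - by split; [exact: mem_chart_at|exact: eball_center].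
  - by move=> q /UV /interior_subset.
  by split; apply: local_centralizer => //; rewrite addnC.
have nbh m : exists U, [/\ open U, U m & mutual_centralizers w pi1 pi2 U].
  have [U [oU Um _ UE]] := loc m setT filterT.
  by exists U.
split; apply: global_centralizer => // m; have [U [oU Um [UE1 UE2]]] := nbh m; by exists U.
Qed.
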